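(* Let $\mathcal{D}\prec\mathcal{G}$ be a flag of reduced holomorphic distributions on $\mathbb{P}^{n}$. Suppose that $\mathcal{G}$ is holomorphically decomposable, i.e., in homogeneous coordinates $\mathcal{G}$ is given by $$\omega=\omega_1\wedge\cdots\wedge\omega_k$$ for some homogeneous $1$-forms $\omega_i$. If the tangent sheaf of $\mathcal{D}$ is split and $\mathrm{codim}(\mathrm{Sing}(\mathcal{G}))\ge n-\dim(\mathcal{D})+1$, then $$\min_i\{\deg(\omega_i)\}\le\deg(\mathcal{D})+1.$$ In particular: (1) If $\mathcal{G}=\mathcal{F}_1\cap\cdots\cap\mathcal{F}_k$ is a complete intersection, i.e., each $\mathcal{F}_i$ is a codimension one foliation induced by $\omega_i$ (and so $\mathcal{G}$ is integrable), then $\min_i\{\deg(\mathcal{F}_i)\}\le\deg(\mathcal{D})$. (2) If all the forms $\omega_i$ have the same degree, then $\deg(\mathcal{G})\le\mathrm{codim}(\mathcal{G})\cdot\deg(\mathcal{D})+\mathrm{codim}(\mathcal{G})-1$.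
   Context: $\mathbb{P}^n$ is complex projective space. A holomorphic distribution of codimension $k$ (dimension $n-k$) and degree $m$ on $\mathbb{P}^{n}$ is induced by a nonzero section $\omega\in H^{0}(\mathbb{P}^{n},\Omega^{k}_{\mathbb{P}^{n}}(m+k+1))$ which is locally a wedge product of $k$ holomorphic $1$-forms outside its singular set (the zero set of $\omega$); equivalently it is given by a homogeneous polynomial $k$-form on $\mathbb{C}^{n+1}$ with coefficients of degree $m+1$, annihilated by contraction with the radial vector field. It is reduced if its singular set has codimension at least $2$; distributions are also assumed to have nonempty singular set. A foliation is an integrable distribution. The degree $\deg(\omega_i)$ of a homogeneous $1$-form on $\mathbb{C}^{n+1}$ is the degree of its polynomial coefficients (so a codimension one foliation induced by $\omega_i$ has degree $\deg(\omega_i)-1$). The tangent sheaf of $\mathcal{D}$, namely the sheaf of vector fields annihilated by its defining form, is split if it is a direct sum of line bundles. $\mathcal{D}\prec\mathcal{G}$ is a flag if $\dim\mathcal{D}<\dim\mathcal{G}$ and the tangent sheaf of $\mathcal{D}$ is a subsheaf of that of $\mathcal{G}$. *)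

(* Defs.v *)
From HB Require Import structures.
From mathcomp Require Import all_boot all_order all_algebra all_fingroup.
From mathcomp Require Import complex.
From mathcomp Require Import -(notations) mpoly.
From mathcomp Require Import boolp classical_sets functions reals topology.
From mathcomp Require Import normedtype derive.

Set Implicit Arguments.
Unset Strict Implicit.
Unset Printing Implicit Defensive.

Import Order.TTheory GRing.Theory Num.Theory.
Import numFieldNormedType.Exports.

Local Open Scope classical_set_scope.
Local Open Scope ring_scope.

(* A k-form w with coefficients in A is stored through its values on tuples  *)
(* of basis vectors: w [tuple i_1; ...; i_k] = w(e_{i_1}, ..., e_{i_k}).     *)
Section Forms.
Context (A : comPzRingType) (N : nat).

Definition form (k : nat) := {ffun k.-tuple 'I_N -> A}.

Definition alternating k (w : form k) : Prop :=
  (forall (s : 'S_k) (t : k.-tuple 'I_N),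
      w [tuple tnth t (s i) | i < k] = (-1) ^+ s * w t) /\
  (forall t : k.-tuple 'I_N, ~~ uniq t -> w t = 0).

(* 1-forms are row vectors of coefficients. *)
Definition wedge k (om : 'I_k -> 'rV[A]_N) : form k :=
  [ffun t : k.-tuple 'I_N => \det (\matrix_(a, b) om a 0 (tnth t b))].

Definition oneform (om : 'rV[A]_N) : form 1 :=
  [ffun t : 1.-tuple 'I_N => om 0 (thead t)].

(* The interior product i_v w, with the convention i_v f = 0 when k = 0. *)
Definition contract k (v : 'rV[A]_N) : form k -> form k.-1 :=
  match k return form k -> form k.-1 with
  | 0 => fun _ => [ffun => 0]
  | k'.+1 => fun w =>
      [ffun t : k'.-tuple 'I_N => \sum_(j < N) v 0 j * w [tuple of j :: t]]
  end.

End Forms.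

(* Packed as a numClosedFieldType so that the generic topology and normed    *)
(* module structures of numFieldNormedType apply.                            *)
Definition Cplx (R : realType) : numClosedFieldType := complex R.

Section ProjectiveSpace.
Context (R : realType) (n : nat).

Local Notation C := (Cplx R).
Local Notation V := 'rV[C]_n.+1.
Local Notation Pol := (mpoly n.+1 C).

Definition peval (p : Pol) (x : V) : C := meval (fun i => x 0 i) p.

Definition homog (d : nat) (p : Pol) : Prop :=
  p \is ishomog1 d (@mdeg n.+1).

(* Subsets of P^n are represented by their cones of nonzero vectors. *)

Definition zeros (S : set Pol) : set V :=
  [set x | x != 0 /\ forall f, S f -> peval f x = 0].

Definition zariski_closed (Z : set V) : Prop :=
  exists2 S : set Pol,
    (forall f, S f -> exists d, homog d f) & Z = zeros S.

Definition zariski_irreducible (Z : set V) : Prop :=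
  [/\ zariski_closed Z, Z !=set0 &
      forall A B, zariski_closed A -> zariski_closed B ->
        Z `<=` A `|` B -> Z `<=` A \/ Z `<=` B].

(* codim Z >= c, i.e. dim Z + c <= n, where dim Z is the Krull dimension:    *)
(* the largest d for which Z contains a chain W_0 < ... < W_d of irreducible *)
(* closed subsets.                                                           *)
Definition codim_ge (Z : set V) (c : nat) : Prop :=
  forall (d : nat) (W : nat -> set V),
    (forall i, (i <= d)%N -> zariski_irreducible (W i) /\ W i `<=` Z) ->
    (forall i, (i < d)%N -> W i `<` W i.+1) ->
    (d + c <= n)%N.

Definition feval k (w : form Pol n.+1 k) (x : V) : form C n.+1 k :=
  [ffun t : k.-tuple 'I_n.+1 => peval (w t) x].

Definition fsing k (w : form Pol n.+1 k) : set V :=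
  [set x | x != 0 /\ feval w x = 0].

Definition radial : 'rV[Pol]_n.+1 := \row_j mpolyX C (mnm1 j).

(* The wedge decomposition can be stated on C^{n+1} rather than on P^n:      *)
(* 1-forms on P^n pull back to C^{n+1}, and conversely a decomposition near  *)
(* p restricts to an affine hyperplane through p, which is a chart of P^n    *)
(* and trivializes the twist by O(m + k + 1).                                *)
Definition locally_decomposable k (w : form Pol n.+1 k) : Prop :=
  forall p : V, p != 0 -> ~ fsing w p ->
  exists (U : set V) (eta : 'I_k -> V -> V),
    [/\ open U, U p,
        (forall a x, U x -> differentiable (eta a) x) &
        (forall x, U x -> feval w x = wedge (fun a => eta a x))].

(* For k > 0 the degree is nonnegative: by contraction with the radial field *)
(* a form with constant coefficients is 0.                                   *)
Record distribution (k : nat) := Distribution {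
  deg : nat;
  dform : form Pol n.+1 k;
  dform_neq0 : dform <> 0;
  dform_alternating : alternating dform;
  dform_homog : forall t, homog deg.+1 (dform t);
  dform_radial : contract radial dform = 0;
  dform_decomposable : locally_decomposable dform;
  dform_sing : fsing dform !=set0
}.

Definition dist_codim k (D : distribution k) : nat := k.
Definition dist_dim k (D : distribution k) : nat := (n - k)%N.
Definition Sing k (D : distribution k) : set V := fsing (dform D).
Definition reduced k (D : distribution k) : Prop := codim_ge (Sing D) 2.

(* Cone of a Euclidean open subset of P^n. *)
Definition conic_open (U : set V) : Prop :=
  [/\ open U, ~ U 0 & forall (l : C) x, l != 0 -> U x -> U (l *: x)].

(* Holomorphic (i.e. complex differentiable) functions on the open subset of *)
(* P^n with cone U, as functions homogeneous of degree 0.                    *)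
Definition holo_fun (U : set V) (g : V -> C) : Prop :=
  (forall x, U x -> differentiable g x) /\
  (forall (l : C) x, l != 0 -> U x -> g (l *: x) = g x).

(* Sections of O(1)^{n+1}.  By the Euler sequence                            *)
(*   0 -> O -> O(1)^{n+1} -> TP^n -> 0,                                      *)
(* where 1 in O maps to the radial field, a vector field on P^n is locally   *)
(* given by such a section modulo holo_radial.                               *)
Definition holo_vfield (U : set V) (v : V -> V) : Prop :=
  (forall x, U x -> differentiable v x) /\
  (forall (l : C) x, l != 0 -> U x -> v (l *: x) = l *: v x).

Definition holo_radial (U : set V) (v : V -> V) : Prop :=
  exists2 h, holo_fun U h & forall x, U x -> v x = h x *: x.

(* A sheaf F of O-submodules of TP^n is represented by its preimage in       *)
(* O(1)^{n+1}, i.e. by a sheaf of O-submodules containing the multiples of   *)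
(* the radial field; F itself is the quotient by holo_radial.                *)
Definition tsheaf := set V -> set (V -> V).

Definition is_subsheaf (F : tsheaf) : Prop :=
  forall U, conic_open U ->
  [/\ F U `<=` holo_vfield U,
      holo_radial U `<=` F U,
      (forall g v w, holo_fun U g -> F U v -> F U w ->
         F U (fun x => g x *: v x + w x)),
      (forall U', conic_open U' -> U' `<=` U -> F U `<=` F U') &
      (forall v, holo_vfield U v ->
         (forall p, U p -> exists U', [/\ conic_open U', U' p, U' `<=` U &
                                         F U' v]) ->
         F U v)].

(* Modulo the radial field, F is locally free of rank one. *)
Definition line_bundle (F : tsheaf) : Prop :=
  is_subsheaf F /\
  forall p : V, p != 0 ->
  exists (U : set V) (s : V -> V),
    [/\ conic_open U, U p &
     forall U', conic_open U' -> U' `<=` U ->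
       (forall v, F U' v <->
          exists g h, [/\ holo_fun U' g, holo_fun U' h &
                         forall x, U' x -> v x = g x *: s x + h x *: x]) /\
       (forall g, holo_fun U' g -> holo_radial U' (fun x => g x *: s x) ->
          forall x, U' x -> g x = 0)].

(* Modulo the radial field, F is the internal direct sum of the L i. *)
Definition direct_sum (F : tsheaf) (r : nat) (L : 'I_r -> tsheaf) : Prop :=
  forall U, conic_open U ->
  [/\ (forall i, L i U `<=` F U),
      (forall v, F U v -> forall p, U p ->
         exists U' (u : 'I_r -> V -> V) (h : V -> C),
           [/\ conic_open U', U' p /\ U' `<=` U,
               (forall i, L i U' (u i)), holo_fun U' h &
               forall x, U' x -> v x = \sum_i u i x + h x *: x]) &
      (forall u : 'I_r -> V -> V, (forall i, L i U (u i)) ->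
         holo_radial U (fun x => \sum_i u i x) ->
         forall i, holo_radial U (u i))].

Definition tangent_sheaf k (D : distribution k) : tsheaf := fun U =>
  [set v | holo_vfield U v /\
           forall x, U x -> contract (v x) (feval (dform D) x) = 0].

Definition split_sheaf (F : tsheaf) : Prop :=
  exists (r : nat) (L : 'I_r -> tsheaf),
    (forall i, line_bundle (L i)) /\ direct_sum F L.

Definition lie_bracket (v w : V -> V) : V -> V :=
  fun x => 'd w x (v x) - 'd v x (w x).

Definition integrable k (D : distribution k) : Prop :=
  forall U v w, conic_open U -> tangent_sheaf D U v -> tangent_sheaf D U w ->
  forall x, U x -> contract (lie_bracket v w x) (feval (dform D) x) = 0.

Definition flag k l (D : distribution k) (G : distribution l) : Prop :=
  (dist_dim D < dist_dim G)%N /\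
  forall U, conic_open U -> tangent_sheaf D U `<=` tangent_sheaf G U.

Definition homog_oneform (d : nat) (om : 'rV[Pol]_n.+1) : Prop :=
  forall j, homog d (om 0 j).

End ProjectiveSpace.

(* Main.v *)
Require Import Defs.
From mathcomp Require Import all_boot all_order all_algebra all_fingroup finmap.
From mathcomp Require Import complex.
From mathcomp Require Import -(notations) mpoly.
From mathcomp Require Import boolp classical_sets functions cardinality reals.
From mathcomp Require Import ereal topology normedtype derive lebesgue_measure.
From mathcomp Require Import ring zify.
Import Defs.

(** Every factor omega_i of G has degree at most deg D + 1.

    Let eta be the q-form defining D, with coefficients of degree deg D + 1,
    and let omega be one of the omega_i, of degree d.

    Since D is tangent to G, omega /\ eta = 0.  Indeed, on q + 1 given basis
    vectors omega /\ eta depends linearly on omega, hence is the value of omega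
    on some polynomial vector field.  By the Pluecker relations, i.e. since eta
    is locally decomposable, this field is in the kernel of eta.  Up to a power
    of a coordinate it is a local section of the tangent sheaf of D, so it is
    annihilated by omega_1 /\ ... /\ omega_k, and by Cramer's rule by each
    omega_i ([flag_annihilates]).

    The zeros of omega lie in Sing G, so they have codimension at least q + 1.
    Under this condition the de Rham - Saito division lemma says that
    omega /\ eta = 0 forces eta = omega /\ gamma, whence d <= deg D + 1 by
    comparing degrees ([cycle_degree_bound]).

    The division lemma is proved after restricting the coefficients to a
    linear subspace L of dimension r >= q + 1 that avoids the zeros of omega
    and on which eta does not vanish.  Such an L is cut out by hyperplanes,
    each lowering the dimension of the zero locus by one
    ([hyperplane_section]); choosing them uses that closed sets satisfy the
    descending chain condition, i.e. Dickson's lemma and leading monomials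
    ([no_ascending_ideals]).  On L the coefficients of omega have no common
    zero but the origin, so by the Nullstellensatz some power y_s^K of each
    coordinate is a combination of them, say y_s^K = omega(u_s).  By Cartan's
    formula y_s^K eta = i_(u_s)(omega /\ eta) + omega /\ i_(u_s) eta, and as
    the y_s^K form a regular sequence of length r > q, an induction on the
    degree of eta, working modulo y_1^K, ..., y_s^K, yields the division
    ([koszul_exact]).

    Part (1) also needs that G is integrable: off the zeros of
    omega_1 /\ ... /\ omega_k a field tangent to G is annihilated by each
    omega_i, and by density and continuity this holds everywhere
    ([contract_wedge_open]).  Part (2) is the sum of the bounds on the
    degrees, since deg G + 1 is the sum of the degrees of the omega_i. *)

Set Implicit Arguments.
Unset Strict Implicit.
Unset Printing Implicit Defensive.

Import Order.TTheory GRing.Theory Num.Theory.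
Import numFieldNormedType.Exports.

Local Open Scope classical_set_scope.
Local Open Scope ring_scope.

(** * Ideals and regular sequences *)

Section Ideals.
Variable A : comNzRingType.
Implicit Types P : A -> Prop.

Record ideal P : Prop := Ideal {
  ideal0 : P 0;
  idealD : forall f g, P f -> P g -> P (f + g);
  idealM : forall a f, P f -> P (a * f) }.

Lemma idealN P : ideal P -> forall f, P f -> P (- f).
Proof. by move=> hP f Pf; rewrite -mulN1r; apply: idealM. Qed.

Lemma idealB P : ideal P -> forall f g, P f -> P g -> P (f - g).
Proof. by move=> hP f g Pf Pg; apply: idealD => //; apply: idealN. Qed.

Lemma ideal_sum P (I : Type) (r : seq I) (Q : pred I) (F : I -> A) :
  ideal P -> (forall i, Q i -> P (F i)) -> P (\sum_(i <- r | Q i) F i).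
Proof. by move=> [P0 PD _] PF; elim/big_rec: _ => // i x Qi; apply/PD/PF. Qed.

Definition spanned (I : finType) (Q : pred I) (x : I -> A) (f : A) : Prop :=
  exists c : I -> A, f = \sum_(i | Q i) c i * x i.

Lemma spanned_ideal (I : finType) (Q : pred I) (x : I -> A) :
  ideal (spanned Q x).
Proof.
split=> [|f g [c ->] [c' ->]|a f [c ->]].
- by exists (fun=> 0); rewrite big1 // => i _; rewrite mul0r.
- exists (fun i => c i + c' i); rewrite -big_split /=.
  by apply: eq_bigr => i _; rewrite mulrDl.
- exists (fun i => a * c i); rewrite big_distrr /=.
  by apply: eq_bigr => i _; rewrite mulrA.
Qed.

Lemma spanned_gen (I : finType) (Q : pred I) (x : I -> A) i :
  Q i -> spanned Q x (x i).
Proof.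
move=> Qi; exists (fun j => (j == i)%:R).
rewrite (bigD1 i) //= eqxx mul1r big1 ?addr0 // => j /andP[_ /negPf->].
by rewrite mul0r.
Qed.

Definition regular_seq (r : nat) (x : 'I_r -> A) : Prop :=
  forall (s : 'I_r) f, spanned (fun i : 'I_r => (i < s)%N) x (x s * f) ->
    spanned (fun i : 'I_r => (i < s)%N) x f.

(** This is how an induction on s, working modulo the first s elements of a
    regular sequence, proceeds. *)
Lemma spanned_step (r : nat) (x : 'I_r -> A) (s : 'I_r) f :
  spanned (fun i : 'I_r => (i < s.+1)%N) x f ->
  exists a, spanned (fun i : 'I_r => (i < s)%N) x (f - x s * a).
Proof.
case=> c ->; exists (c s); exists c.
rewrite (bigD1 s) //= mulrC addrC addrK; apply: eq_bigl => i.
by rewrite ltnS ltn_neqAle andbC.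
Qed.

End Ideals.

(** * The Koszul complex *)

Section Delta.
Variables (A : comNzRingType) (I : finType).
Implicit Types (w u : I -> A) (eta : seq I -> A) (t : seq I).

(** The wedge product with the 1-form w, on forms seen through their values on
    lists of basis vectors; the recursion is i_(e_j)(w /\ eta) = w_j eta -
    w /\ i_(e_j) eta.  It makes sense and squares to zero for arbitrary
    functions on lists, so no alternation is carried around. *)
Fixpoint delta w eta t : A :=
  if t is j :: t' then w j * eta t' - delta w (fun s => eta (j :: s)) t' else 0.

Definition iprod u eta t : A := \sum_j u j * eta (j :: t).

Lemma eq_delta w eta eta' t :
  (forall s, size s = (size t).-1 -> eta s = eta' s) ->
  delta w eta t = delta w eta' t.
Proof.
elim: t eta eta' => //= j t IH eta eta' e; rewrite e //; congr (_ - _).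
by case: t IH e => // i t IH e; apply: IH => s hs; apply: e; rewrite /= hs.
Qed.

Lemma delta_sum w (J : Type) (r : seq J) (c : J -> A) (eta : J -> seq I -> A) t :
  delta w (fun s => \sum_(j <- r) c j * eta j s) t =
  \sum_(j <- r) c j * delta w (eta j) t.
Proof.
elim: t eta => [|i t IH] eta /=; first by rewrite big1 // => j _; rewrite mulr0.
rewrite IH big_distrr -sumrB; apply: eq_bigr => j _ /=.
by rewrite mulrBr mulrCA.
Qed.

Lemma deltaD w a eta eta' t :
  delta w (fun s => eta s + a * eta' s) t = delta w eta t + a * delta w eta' t.
Proof.
elim: t eta eta' => [|i t IH] eta eta' /=; first by rewrite mulr0 addr0.
by rewrite IH mulrDr mulrBr opprD addrACA mulrCA.
Qed.

(** The values of w /\ eta on lists of length p + 1 are combinations of values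
    of eta on lists of length p. *)
Lemma delta_closed w (P : A -> Prop) eta t :
  P 0 -> (forall f g, P f -> P g -> P (f - g)) ->
  (forall i f, P f -> P (w i * f)) ->
  (forall s, size s = (size t).-1 -> P (eta s)) -> P (delta w eta t).
Proof.
move=> P0 PB PM; elim: t eta => [|j t IH] eta Peta //=.
apply: (PB); first exact/PM/Peta.
case: t IH Peta => [|i t] IH Peta //.
by apply: IH => s hs; apply: Peta; rewrite /= hs.
Qed.

Lemma delta_ideal w (P : A -> Prop) eta t : ideal P ->
  (forall s, size s = (size t).-1 -> P (eta s)) -> P (delta w eta t).
Proof.
move=> idP; apply: delta_closed; first exact: ideal0.
  exact: idealB.
by move=> i f; apply: idealM.
Qed.

(** Cartan's formula: contraction with u is a homotopy from multiplication by
    w(u) to zero.  It is the defining recursion of delta, summed over j. *)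
Lemma cartan w u eta t :
  iprod u (delta w eta) t + delta w (iprod u eta) t =
  (\sum_j u j * w j) * eta t.
Proof.
rewrite {2}/iprod delta_sum /iprod -big_split big_distrl /=.
by apply: eq_bigr => j _; rewrite mulrBr subrK mulrA.
Qed.

Lemma delta_delta w eta t : delta w (delta w eta) t = 0.
Proof.
elim: t eta => //= j t IH eta; set eta' := fun s => eta (j :: s).
rewrite -[X in _ - X]/(delta w (fun s => w j * eta s - delta w eta' s) t).
rewrite [X in _ - X](@eq_delta _ _ (fun s => - delta w eta' s + w j * eta s)).
  2: by move=> s _; rewrite addrC.
rewrite deltaD opprD addrCA subrr addr0.
have := deltaD w (-1) (fun=> 0) (delta w eta') t.
rewrite IH mulr0 addr0 (@eq_delta _ _ (fun s => - delta w eta' s)) => [->|s _].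
  rewrite (@delta_ideal _ (fun f => f = 0)) ?oppr0 //.
  by split=> // [f g -> ->|a f ->]; rewrite ?addr0 ?mulr0.
by rewrite add0r mulN1r.
Qed.

(** Exactness of the Koszul complex of w in degrees below the depth of the ideal
    of its coefficients, modulo the first s elements of a regular sequence
    contained in this ideal.  Taking x_s = w(u), Cartan's formula shows that
    i_u eta is a cycle modulo one more element of the sequence, so by induction
    on p it is a boundary there, i_u eta = w /\ beta + x_s g; then
    x_s (eta - w /\ g) vanishes modulo the first s elements, and x_s can be
    cancelled. *)
Theorem koszul_exact (r : nat) (x : 'I_r -> A) w :
  regular_seq x -> (forall s, exists u : I -> A, x s = \sum_j u j * w j) ->
  forall (p s : nat) eta, (p + s < r)%N ->
    (forall t, size t = p.+1 ->
       spanned (fun i : 'I_r => (i < s)%N) x (delta w eta t)) ->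
    exists gamma, forall t, size t = p ->
      spanned (fun i : 'I_r => (i < s)%N) x (eta t - delta w gamma t).
Proof.
move=> regx xw; elim=> [|p IH] s eta lt_ps closed_eta.
  have [u xsE] := xw (Ordinal lt_ps).
  exists (fun=> 0) => t /size0nil->; rewrite subr0.
  apply: (regx (Ordinal lt_ps)); rewrite xsE -cartan /= addr0.
  apply: ideal_sum; first exact: spanned_ideal.
  by move=> j _; apply: idealM; [exact: spanned_ideal | exact: closed_eta].
have lt_sr : (s < r)%N by apply: leq_ltn_trans lt_ps; rewrite leq_addl.
pose o := Ordinal lt_sr; have [u xsE] := xw o.
have idS k := spanned_ideal (fun i : 'I_r => (i < k)%N) x.
have xeta t : size t = p.+1 ->
    spanned (fun i : 'I_r => (i < s)%N) x
      (x o * eta t - delta w (iprod u eta) t).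
  move=> st; rewrite xsE -cartan addrK; apply: ideal_sum => // j _.
  by apply: idealM => //; apply: closed_eta; rewrite /= st.
have [|t st|beta hbeta] := IH s.+1 (iprod u eta).
- by rewrite addnS.
- have [c hc] := xeta t st.
  rewrite -[delta _ _ _](subKr (x o * eta t)) hc; apply: idealB => //.
    by rewrite mulrC; apply: idealM => //; apply: (spanned_gen _ (i := o)) => /=.
  by apply: ideal_sum => // i lt_is; apply: idealM => //; apply: spanned_gen;
     exact: ltnW.
have /choice[g hg] : forall t, exists a, size t = p ->
    spanned (fun i : 'I_r => (i < s)%N) x
      (iprod u eta t - delta w beta t - x o * a).
  move=> t; case: (size t =P p) => [st|?]; last by exists 0.
  by have [a ha] := spanned_step (s := o) (hbeta t st); exists a.
exists g => t st; apply: (regx o).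
rewrite mulrBr -[x o * eta t](subrK (delta w (iprod u eta) t)) -addrA.
apply: idealD; [exact: idS | exact: xeta |].
have -> : delta w (iprod u eta) t - x o * delta w g t =
    delta w (fun s' => iprod u eta s' + -1 * delta w beta s' + - x o * g s') t.
  rewrite (deltaD w _ (fun s' => iprod u eta s' + -1 * delta w beta s')).
  by rewrite deltaD delta_delta mulr0 addr0 mulNr.
apply: delta_ideal => // s' hs'.
by rewrite mulN1r mulNr; apply: hg; rewrite hs' st.
Qed.

End Delta.

(** * Powers of the variables *)

Local Notation mnm_le := mpoly.lem.

Section VariablePowers.
Variables (F : comNzRingType) (r K : nat).

Definition Xpow (i : 'I_r) : mpoly r F := mpolyX F (mnm1 i) ^+ K.

Lemma XpowE i : Xpow i = mpolyX F (mnm_muln (mnm1 i) K).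
Proof. by rewrite /Xpow mpolyXn. Qed.

Lemma mcoeff_mulX_eq0 (p : mpoly r F) (k m : multinom r) :
  ~~ mnm_le k m -> mcoeff m (p * mpolyX F k) = 0.
Proof.
move=> nkm; apply/eqP; rewrite mcoeff_eq0 (perm_mem (msuppMX p k)).
by apply: contra nkm => /mapP[m' _ ->]; rewrite addmC lem_addl.
Qed.

Lemma lem_Xpow (i : 'I_r) (m : multinom r) :
  mnm_le (mnm_muln (mnm1 i) K) m = (K <= m i)%N.
Proof.
apply/mnm_lepP/idP => [/(_ i)|le_K j]; rewrite mulmnE mnm1E.
  by rewrite eqxx mul1n.
by case: eqP => [<-|_]; rewrite ?mul1n ?mul0n.
Qed.

(** Monomial ideals are tested monomial by monomial, which makes the regularity
    of the sequence of powers of the variables evident. *)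
Lemma spanned_XpowP (Q : pred 'I_r) (f : mpoly r F) :
  spanned Q Xpow f <->
  forall m, m \in msupp f -> exists2 i, Q i & (K <= m i)%N.
Proof.
split=> [[c ->] m|supp_f].
  move=> m_supp; apply: contrapT => nQ; move: m_supp.
  rewrite mcoeff_msupp raddf_sum big1 ?eqxx // => i Qi.
  rewrite /= XpowE mcoeff_mulX_eq0 // lem_Xpow; apply/negP => leK.
  by apply: nQ; exists i.
rewrite (mpolyE f) big_seq; elim/big_rec: _ => [|m g m_f g_span].
  exact: ideal0 (spanned_ideal _ _).
apply: (idealD (spanned_ideal _ _)) => //.
have [i Qi leK] := supp_f m m_f.
rewrite -mul_mpolyC; apply: idealM; first exact: spanned_ideal.
have := submK (m := mnm_muln (mnm1 i) K) (m' := m).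
rewrite lem_Xpow => /(_ leK) <-; rewrite mpolyXD -XpowE.
by apply: idealM; [exact: spanned_ideal | exact: spanned_gen].
Qed.

Lemma regular_Xpow : regular_seq Xpow.
Proof.
move=> s f /spanned_XpowP sf; apply/spanned_XpowP => m mf.
have [|i lt_is] := sf (mnm_add (mnm_muln (mnm1 s) K) m).
  by rewrite mulrC XpowE mcoeff_msupp addmC addmC mcoeffMX -mcoeff_msupp.
rewrite mnmDE mulmnE mnm1E -val_eqE eq_sym (ltn_eqF lt_is) mul0n add0n.
by exists i.
Qed.

End VariablePowers.

(** * Dickson's lemma and Noetherianity *)

Section Dickson.
Local Open Scope nat_scope.

(** The subsequence picks each time an index at which the rest of the sequence
    reaches its minimum. *)
Lemma nondecreasing_subseq (g : nat -> nat) :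
  exists2 phi : nat -> nat, {homo phi : a b / (a < b)%N} &
    {homo g \o phi : a b / (a <= b)%N}.
Proof.
have /choice[j hj] N :
    exists j, (N <= j)%N /\ forall k, (N <= k)%N -> (g j <= g k)%N.
  have ex : exists v, `[< exists2 k, (N <= k)%N & g k = v >].
    by exists (g N); apply/asboolP; exists N.
  case: (ex_minnP ex) => v /asboolP[k leNk gk] vmin.
  by exists k; split=> // k' le'; rewrite gk; apply: vmin; apply/asboolP; exists k'.
pose phi k := iter k (fun a => j a.+1) (j 0%N).
have phiS k : (phi k < phi k.+1)%N by have [] := hj (phi k).+1.
exists phi.
  by apply: (@homo_ltn _ _ (fun a b => (a < b)%N)) => // y x z; exact: ltn_trans.
apply: (@homo_leq _ _ (fun a b => (a <= b)%N)) => [a|b a c|k] //.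
  exact: leq_trans.
case: k => [|k]; first by case: (hj 0) => _; apply.
case: (hj (phi k).+1) => _; apply.
by rewrite (ltn_trans (phiS k) (phiS k.+1)).
Qed.

Theorem dickson (n : nat) (f : nat -> multinom n) :
  exists i j, (i < j)%N /\ mnm_le (f i) (f j).
Proof.
suff [phi phi_lt phi_le] : exists2 phi : nat -> nat,
    {homo phi : a b / (a < b)%N} &
    forall i, i \in enum 'I_n -> {homo (fun a => f (phi a) i) : a b / (a <= b)%N}.
  exists (phi 0), (phi 1); split; first exact: phi_lt.
  by apply/mnm_lepP => i; apply: phi_le; rewrite ?mem_enum.
elim: (enum 'I_n) => [|i s [phi phi_lt phi_le]]; first by exists id.
have [psi psi_lt psi_le] := nondecreasing_subseq (fun a => f (phi a) i).
exists (phi \o psi) => [a b ab|i']; first exact/phi_lt/psi_lt.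
rewrite inE => /orP[/eqP->//|i's] a b ab; apply: (phi_le _ i's).
exact: ltnW_homo psi_lt _ _ ab.
Qed.

End Dickson.

Section Noetherian.
Variables (F : fieldType) (n : nat).
Local Notation Pol := (mpoly n F).
Implicit Types J : Pol -> Prop.

(** A witness of J < J' with smallest leading monomial: if the leading monomial
    of h in J divided it, subtracting a multiple of h would make it smaller. *)
Lemma reduced_leading_term J J' : ideal J -> ideal J' ->
  (forall f, J f -> J' f) -> forall f, J' f -> ~ J f ->
  exists g, [/\ J' g, ~ J g &
    forall h, J h -> h != 0 -> ~~ mnm_le (mlead h) (mlead g)].
Proof.
move=> idJ idJ' JJ'; elim/mleadrect => f IH J'f nJf.
have f0 : f != 0 by apply/eqP => e; apply: nJf; rewrite e; apply: ideal0.
case: (pselect (exists h,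
    [/\ J h, h != 0 & mnm_le (mlead h) (mlead f)])); last first.
  move=> nex; exists f; split=> // h Jh h0; apply/negP => le_h.
  by apply: nex; exists h.
case=> h [Jh h0 le_hf].
have lch : mcoeff (mlead h) h != 0 by rewrite mleadc_eq0.
pose c := mcoeff (mlead f) f / mcoeff (mlead h) h.
pose a := c *: mpolyX F (mnm_sub (mlead f) (mlead h)).
have c0 : c != 0 by rewrite mulf_neq0 ?invr_eq0 ?mleadc_eq0.
have a0 : a != 0.
  rewrite /a; apply/eqP => /(congr1 (mcoeff (mnm_sub (mlead f) (mlead h)))) /eqP.
  by rewrite mcoeffZ mcoeffX eqxx mulr1 mcoeff0 (negPf c0).
have leada : mlead (a * h) = mlead f.
  by rewrite mleadM // /a mleadZ // mleadXm submK.
have Jah : J (a * h) by apply: idealM.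
have nJ : ~ J (f - a * h).
  by move=> J1; apply: nJf; rewrite -(subrK (a * h) f); apply: idealD.
apply: (IH (f - a * h)) => //; last by apply: idealB => //; exact: JJ'.
have lead_ah : mcoeff (mlead f) (a * h) = mcoeff (mlead f) f.
  rewrite -{1}leada mleadM // mleadcM /a mleadZ // mleadXm mcoeffZ mcoeffX eqxx.
  by rewrite mulr1 divfK.
have fah0 : f - a * h != 0 by apply/eqP => e; apply: nJ; rewrite e; apply: ideal0.
rewrite lt_neqAle (le_trans (mleadB_le _ _)) ?leada ?joinxx // andbT.
apply: contraNneq fah0 => e.
by rewrite -mleadc_eq0 e mcoeffB lead_ah subrr.
Qed.

(** In a strictly ascending chain, reduced witnesses of the successive strict
    inclusions have leading monomials none of which divides a later one,
    against Dickson's lemma. *)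
Theorem no_ascending_ideals (J : nat -> Pol -> Prop) :
  (forall i, ideal (J i)) -> (forall i f, J i f -> J i.+1 f) ->
  exists i, forall f, J i.+1 f -> J i f.
Proof.
move=> idJ JS; apply: contrapT => strict.
have /choice[g hg] i : exists g, [/\ J i.+1 g, ~ J i g &
    forall h, J i h -> h != 0 -> ~~ mnm_le (mlead h) (mlead g)].
  have [f J'f nJf] : exists2 f, J i.+1 f & ~ J i f.
    apply: contrapT => nex; apply: strict; exists i => f Jf.
    by apply: contrapT => nJf; apply: nex; exists f.
  exact: (reduced_leading_term (idJ i) (idJ i.+1) (JS i) J'f nJf).
have [i [j [lt_ij le_ij]]] := dickson (fun i => mlead (g i)).
have Jle a b : (a <= b)%N -> forall f, J a f -> J b f.
  by move/subnKC <-; elim: (b - a)%N => [|k IH] f Jf;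
    rewrite ?addn0 // addnS; apply/JS/IH.
have [Jgi nJgi _] := hg i; have [_ _ /(_ (g i))] := hg j.
rewrite le_ij => /(_ (Jle _ _ lt_ij _ Jgi)) h; have // : ~~ true; apply: h.
by apply/eqP => e; apply: nJgi; rewrite e; apply: ideal0.
Qed.

Theorem maximal_ideal_in (S : (Pol -> Prop) -> Prop) J0 :
  (forall J, S J -> ideal J) -> S J0 ->
  exists2 J, S J & forall J', S J' -> (forall f, J f -> J' f) ->
    forall f, J' f -> J f.
Proof.
move=> idS SJ0; apply: contrapT => nomax.
have next (J : {J | S J}) : exists J' : {J | S J},
    (forall f, sval J f -> sval J' f) /\ exists2 f, sval J' f & ~ sval J f.
  case: J => J SJ /=; apply: contrapT => nex; apply: nomax.
  exists J => // J' SJ' JJ' f J'f; apply: contrapT => nJf.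
  by apply: nex; exists (exist _ J' SJ'); split=> //; exists f.
have [nx hnx] := choice next.
pose T k := iter k nx (exist _ J0 SJ0).
have [|k f Jf|k hk] := @no_ascending_ideals (fun k => sval (T k)).
- by move=> k; apply/idS/svalP.
- by have [h _] := hnx (T k); apply: h.
- by have [_ [f h1 h2]] := hnx (T k); apply: h2; apply: hk.
Qed.

End Noetherian.

(** * The Nullstellensatz *)

Section MaximalIdeals.
Variables (F : fieldType) (n : nat).
Local Notation Pol := (mpoly n F).
Variable M : Pol -> Prop.
Hypotheses (idM : ideal M) (M1 : ~ M 1).
Hypothesis maxM : forall J, ideal J -> ~ J 1 -> (forall f, M f -> J f) ->
  forall f, J f -> M f.

Lemma maximal_inverse f : ~ M f -> exists g, M (f * g - 1).
Proof.
move=> nMf; apply: contrapT => nex; apply: nMf.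
apply: (maxM (J := fun a => exists b, M (a - f * b))).
- split=> [|a b [u Mu] [v Mv]|c a [u Mu]].
  + by exists 0; rewrite mulr0 subr0; apply: ideal0.
  + by exists (u + v); rewrite mulrDr opprD addrACA; apply: idealD.
  + by exists (c * u); rewrite mulrCA -mulrBr; apply: idealM.
- by case=> b Mb; apply: nex; exists b; rewrite -opprB; apply: idealN.
- by move=> a Ma; exists 0; rewrite mulr0 subr0.
- by exists 1; rewrite mulr1 subrr; apply: ideal0.
Qed.

(** Each factor outside M is invertible modulo M, hence can be cancelled. *)
Lemma maximal_prime_prod (I : Type) (r : seq I) (f : I -> Pol) :
  M (\prod_(i <- r) f i) -> exists i, M (f i).
Proof.
elim: r => [|i r IH]; first by rewrite big_nil => /M1.
rewrite big_cons => Mp; case: (pselect (M (f i))) => [|/maximal_inverse[g Mg]].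
  by exists i.
apply: IH; set p := \prod_(_ <- r) _ in Mp *.
have -> : p = g * (f i * p) - p * (f i * g - 1) by ring.
by apply: idealB => //; apply: idealM.
Qed.

End MaximalIdeals.

Lemma mpoly_ring_ind (F : comNzRingType) (n : nat) (P : mpoly n F -> Prop) :
  (forall c, P (mpolyC n c)) -> (forall i, P (mpolyX F (mnm1 i))) ->
  (forall f g, P f -> P g -> P (f + g)) ->
  (forall f g, P f -> P g -> P (f * g)) -> forall f, P f.
Proof.
move=> PC PX PD PM f; have P1 : P 1 by rewrite -mpolyC1.
rewrite (mpolyE f); elim/big_rec: _ => [|m a _ Pa]; first by rewrite -mpolyC0.
apply: (PD) => //; rewrite -mul_mpolyC; apply: (PM) => //.
rewrite mpolyXE_id; elim/big_rec: _ => // i a' _ Pa'; apply: (PM) => //.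
by elim: (m i) => [|k IH]; rewrite ?expr0 // exprS; apply: (PM).
Qed.

Section LinearDependence.
Variables (F : fieldType) (n D : nat).

Lemma bounded_degree_dependent (k : nat) (g : 'I_k -> mpoly n F) :
  (#|{: bmultinom n D}| < k)%N -> (forall a, msize (g a) <= D)%N ->
  exists2 lam : 'I_k -> F, (exists a, lam a != 0) &
    \sum_a lam a *: g a = 0.
Proof.
move=> lt_k sz_g.
pose A := \matrix_(a < k, b < #|{: bmultinom n D}|)
  mcoeff (bmnm (enum_val b)) (g a).
have /rowV0Pn[v /sub_kermxP vA v0] : kermx A != 0.
  rewrite kermx_eq0 /row_free ltn_eqF //.
  exact: leq_ltn_trans (rank_leq_col A) lt_k.
exists (fun a => v 0 a).
  apply: contrapT => nex; move/eqP: v0; apply; apply/rowP => a; rewrite mxE.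
  by apply/eqP; apply: contrapT => va; apply: nex; exists a; apply/negP.
apply/mpolyP => m; rewrite mcoeff0 raddf_sum /=.
case: (ltnP (mdeg m) D) => [lt_mD|le_Dm].
  have /rowP/(_ (enum_rank (BMultinom lt_mD))) := vA.
  rewrite mxE [RHS]mxE => e; rewrite -[RHS]e; apply: eq_bigr => a _.
  by rewrite mcoeffZ !mxE enum_rankK.
rewrite big1 // => a _; rewrite mcoeffZ.
suff /eqP -> : mcoeff m (g a) == 0 by rewrite mulr0.
rewrite mcoeff_eq0; apply: contraTN le_Dm => /msize_mdeg_lt lt_m.
by rewrite -ltnNge (leq_trans lt_m).
Qed.

End LinearDependence.

(** An uncountable set in the form in which it is used: a partition into
    countably many classes has a class with arbitrarily many elements. *)
Definition uncountable (F : eqType) : Prop :=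
  forall g : F -> nat, exists D, forall k, exists s : seq F,
    [/\ uniq s, size s = k & all (fun c => g c == D) s].

Section Nullstellensatz.
Variables (F : closedFieldType) (n : nat).
Hypothesis uncF : uncountable F.
Local Notation Pol := (mpoly n F).
Local Notation cst := (@mpolyC n F).
Local Notation Xv i := (mpolyX F (mnm1 i)).

(** If no X_i - c is in M, each has an inverse g_c modulo M.  By uncountability
    there are, among the g_c of some bounded degree, more than the number of
    monomials of that degree, so they satisfy a linear relation.  Clearing
    denominators gives a nonzero polynomial in X_i alone that lies in M; it
    splits into linear factors, one of which is in M since M is prime. *)
Lemma maximal_coordinate (M : Pol -> Prop) : ideal M -> ~ M 1 ->
  (forall J, ideal J -> ~ J 1 -> (forall f, M f -> J f) ->
     forall f, J f -> M f) ->
  forall i : 'I_n, exists c, M (Xv i - cst c).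
Proof.
move=> idM M1 maxM i; apply: contrapT => nex.
have /choice[g Mg] c : exists g, M ((Xv i - cst c) * g - 1).
  by apply: maximal_inverse => // Mc; apply: nex; exists c.
have [D hD] := uncF (fun c => msize (g c)).
have [s [uniq_s size_s /allP gs]] := hD #|{: bmultinom n D}|.+1.
set k := _.+1 in size_s; pose c (a : 'I_k) := s`_a.
have c_s a : c a \in s by rewrite mem_nth // size_s.
have c_inj : injective c.
  by move=> a b /eqP; rewrite nth_uniq ?size_s // => /eqP/val_inj.
have [|a|lam [a0 lam0] dep] :=
    @bounded_degree_dependent _ n D k (fun a => g (c a)).
- exact: ltnSn.
- by rewrite (eqP (gs _ (c_s a))).
pose ev : {poly F} -> Pol := fun h => (map_poly cst h).[Xv i].
have evX z : ev ('X - z%:P) = Xv i - cst z.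
  by rewrite /ev rmorphB /= map_polyX map_polyC hornerD hornerN hornerX hornerC.
have evM (I : Type) (r : seq I) (P : pred I) (h : I -> {poly F}) :
    ev (\prod_(j <- r | P j) h j) = \prod_(j <- r | P j) ev (h j).
  by rewrite /ev rmorph_prod /= horner_prod.
(* h / prod_b (T - c_b) = sum_a lam_a / (T - c_a) *)
pose h := \sum_a lam a *: \prod_(b | b != a) ('X - (c b)%:P).
have h0 : h != 0.
  apply/eqP => /(congr1 (horner^~ (c a0))) /eqP.
  rewrite horner0 /h horner_sum (bigD1 a0) //= [X in _ + X]big1 ?addr0 => [|a aa0].
    rewrite hornerZ mulf_eq0 (negPf lam0) horner_prod /=.
    rewrite prodf_seq_eq0 => /hasP[b _] /andP[ba0].
    by rewrite hornerXsubC subr_eq0 => /eqP/c_inj e; rewrite e eqxx in ba0.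
  rewrite hornerZ horner_prod (bigD1 a0) 1?eq_sym //= hornerXsubC subrr.
  by rewrite mul0r mulr0.
have Mh : M (ev h).
  have -> : ev h = - \sum_a cst (lam a) * (\prod_(b | b != a) (Xv i - cst (c b)))
                    * ((Xv i - cst (c a)) * g (c a) - 1).
    have e : \prod_b (Xv i - cst (c b)) * \sum_a lam a *: g (c a) = 0.
      by rewrite dep mulr0.
    apply/eqP; rewrite -addr_eq0 -[X in _ == X]e mulr_sumr; apply/eqP.
    rewrite /ev /h rmorph_sum /= horner_sum -big_split; apply: eq_bigr => a _ /=.
    rewrite map_polyZ hornerZ -/(ev _) evM [in RHS](bigD1 a) //=.
    rewrite -[_ *: g _]mul_mpolyC.
    under eq_bigr do rewrite evX.
    by ring.
  apply: idealN => //; apply: ideal_sum => // a _; exact: idealM.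
have [rs hE] := closed_field_poly_normal h.
have := Mh; rewrite hE /ev map_polyZ hornerZ -/(ev _) evM.
move=> Mp; have [] :=
    @maximal_prime_prod _ _ M idM M1 maxM _ rs (fun z => ev ('X - z%:P)).
  have eqp (p : Pol) : p = cst (lead_coef h)^-1 * (cst (lead_coef h) * p).
    by rewrite mulrA -mpolyCM mulVf ?lead_coef_eq0 // mpolyC1 mul1r.
  by rewrite [Y in M Y]eqp; apply: idealM.
by move=> z; rewrite evX => Mz; apply: nex; exists z.
Qed.

Lemma mod_point (M : Pol -> Prop) (x : 'I_n -> F) : ideal M ->
  (forall i, M (Xv i - cst (x i))) -> forall f, M (f - cst (meval x f)).
Proof.
move=> idM Mx; elim/mpoly_ring_ind => [c|i|a b Ma Mb|a b Ma Mb].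
- by rewrite mevalC subrr; apply: ideal0.
- by rewrite mevalXU.
- by rewrite mevalD mpolyCD opprD addrACA; apply: idealD.
- rewrite mevalM mpolyCM.
  have -> : a * b - cst (meval x a) * cst (meval x b) =
      b * (a - cst (meval x a)) + cst (meval x a) * (b - cst (meval x b)) by ring.
  by apply: idealD => //; apply: idealM.
Qed.

Theorem weak_nullstellensatz (J : Pol -> Prop) : ideal J -> ~ J 1 ->
  exists x : 'I_n -> F, forall f, J f -> meval x f = 0.
Proof.
move=> idJ J1.
have [||M [idM M1 JM] maxM] := @maximal_ideal_in F n
  (fun J' => [/\ ideal J', ~ J' 1 & forall f, J f -> J' f]) J.
- by move=> ? [].
- by split.
have /choice[x Mx] : forall i, exists c, M (Xv i - cst c).
  apply: maximal_coordinate => // J' idJ' J'1 MJ'; apply: maxM => //.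
  by split=> // f /JM/MJ'.
exists x => f /JM Mf; apply: contrapT => /eqP fx0; apply: M1.
have -> : 1 = cst (meval x f)^-1 * (f - (f - cst (meval x f))) :> Pol.
  by rewrite subKr -mpolyCM mulVf.
by apply: idealM => //; apply: idealB => //; exact: mod_point.
Qed.

End Nullstellensatz.

(** * Homogeneous components and the graded Nullstellensatz *)

Section HomogeneousComponents.
Variables (F : comNzRingType) (n : nat).
Local Notation Pol := (mpoly n F).
Local Notation hom d := (@ishomog1 n F d (@mdeg n)).
Local Notation comp d := (@pihomog n F (@mdeg n) d).

Lemma pihomog_homog (d e : nat) (p : Pol) :
  p \is hom d -> comp e p = if e == d then p else 0.
Proof.
by case: eqP => [->|/eqP ne] hp;
  [rewrite pihomog_dE | rewrite (pihomog_ne0 _ hp) 1?eq_sym].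
Qed.

Lemma pihomogM (d e : nat) (p q : Pol) :
  q \is hom d -> comp (e + d) (p * q) = comp e p * q.
Proof.
move=> hq; pose K := maxn (msize p) e.+1.
have pE : p = \sum_(k < K) comp k p by apply: pihomog_partitionE; rewrite leq_maxl.
have lt_eK : (e < K)%N by rewrite leq_maxr.
rewrite {1}pE big_distrl linear_sum /= (bigD1 (Ordinal lt_eK)) //= big1 => [|k ne].
  by rewrite addr0 (pihomog_homog _ (dhomogM (pihomogP _ e p) hq)) eqxx.
rewrite (pihomog_homog _ (dhomogM (pihomogP _ k p) hq)) eqn_add2r eq_sym.
by rewrite -(inj_eq val_inj) /= in ne; rewrite (negPf ne).
Qed.

Lemma pihomogM_lt (d e : nat) (p q : Pol) :
  (e < d)%N -> q \is hom d -> comp e (p * q) = 0.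
Proof.
move=> lt_ed hq; rewrite (pihomog_partitionE (leqnn (msize p))) big_distrl.
rewrite linear_sum big1 //= => k _.
rewrite (pihomog_homog _ (dhomogM (pihomogP _ k p) hq)); case: eqP => // e_kd.
by rewrite e_kd ltnNge leq_addl in lt_ed.
Qed.

Lemma spanned_pihomog (I : finType) (a : I -> Pol) (d e : nat) (f : Pol) :
  (forall i, a i \is hom d) -> spanned predT a f -> spanned predT a (comp e f).
Proof.
move=> ha [c ->]; rewrite linear_sum /=; apply: ideal_sum => [|i _].
  exact: spanned_ideal.
rewrite [in c i * a i](pihomog_partitionE (leqnn (msize (c i)))) big_distrl.
rewrite linear_sum /=.
apply: ideal_sum => [|k _]; first exact: spanned_ideal.
rewrite (pihomog_homog _ (dhomogM (pihomogP _ k _) (ha i))).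
case: eqP => _; last exact: ideal0 (spanned_ideal _ _).
by apply: idealM; [exact: spanned_ideal | exact: spanned_gen].
Qed.

End HomogeneousComponents.

Section HomogeneousNullstellensatz.
Variables (F : closedFieldType) (r : nat).
Hypothesis uncF : uncountable F.
Local Notation Pol := (mpoly r F).
Local Notation hom d := (@ishomog1 r F d (@mdeg r)).
Local Notation comp d := (@pihomog r F (@mdeg r) d).

(** The ideal generated by the a_i and X_j - 1 has no zero, so h (1 - X_j) = 1
    modulo the a_i for some h.  Since the a_i are homogeneous, this can be read
    degree by degree: the component of h of degree e is X_j ^ e modulo the a_i,
    and it vanishes for e large. *)
Theorem homogeneous_nullstellensatz (I : finType) (a : I -> Pol) (d : nat) :
  (forall i, a i \is hom d) ->
  (forall x : 'I_r -> F, (forall i, meval x (a i) = 0) -> forall j, x j = 0) ->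
  exists K, forall j, spanned predT a (Xpow F K j).
Proof.
move=> ha a0; have idS := spanned_ideal predT a.
suff /choice[K hK] : forall j, exists K, spanned predT a (Xpow F K j).
  exists (\max_j K j)%N => j; rewrite /Xpow -(subnK (leq_bigmax j)) exprD.
  by apply: idealM => //; apply: hK.
move=> j; pose X := mpolyX F (mnm1 j).
have [h hh] : exists h, spanned predT a (1 - h * (1 - X)).
  apply: contrapT => nex.
  pose J f := exists h, spanned predT a (f - h * (1 - X)).
  have idJ : ideal J.
    split=> [|f g [u hu] [v hv]|c f [u hu]].
    - by exists 0; rewrite mul0r subr0; apply: ideal0.
    - by exists (u + v); rewrite mulrDl opprD addrACA; apply: idealD.
    - by exists (c * u); rewrite -mulrA -mulrBr; apply: idealM.
  have [x xJ] := weak_nullstellensatz uncF idJ nex.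
  have xj : 1 = x j.
    apply/eqP; rewrite -subr_eq0 -(mevalXU x j) -[1](meval1 x) -mevalB; apply/eqP.
    by apply: xJ; exists 1; rewrite mul1r subrr; apply: ideal0.
  have := oner_neq0 F; rewrite xj a0 ?eqxx // => i.
  apply: xJ; exists 0; rewrite mul0r subr0; exact: spanned_gen.
have comp_h e : spanned predT a (X ^+ e - comp e h).
  have homX : X \is hom 1 by rewrite dhomogX /= mdeg1.
  elim: e => [|e IH].
    have := spanned_pihomog 0 ha hh.
    rewrite mulrBr mulr1 !pihomogB (pihomogM_lt _ _ homX) // subr0.
    by rewrite (pihomog_homog _ (dhomog1 _ _)) expr0.
  have := spanned_pihomog e.+1 ha hh.
  rewrite mulrBr mulr1 !pihomogB (pihomog_homog _ (dhomog1 _ _)) /= sub0r.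
  have -> : comp e.+1 (h * X) = comp e h * X by rewrite -addn1 (pihomogM _ _ homX).
  move=> h1.
  have -> : X ^+ e.+1 - comp e.+1 h =
      X * (X ^+ e - comp e h) + - (comp e.+1 h - comp e h * X).
    by rewrite exprS; ring.
  by apply: idealD => //; apply: idealM.
exists (msize h); have := comp_h (msize h); rewrite /Xpow.
rewrite pihomogE big_seq_cond big1 ?subr0 // => m /andP[m_h /eqP e].
by have := msize_mdeg_lt m_h; rewrite e ltnn.
Qed.
End HomogeneousNullstellensatz.

(** * The complex numbers are uncountable *)

(** Otherwise all the classes are finite and the real line is countable, hence
    of measure zero, whereas [0, 1] has measure 1. *)
Lemma uncountable_real (R : realType) : uncountable R.
Proof.
move=> g; apply: contrapT => nex.
have fin_fiber D : finite_set [set x | g x = D].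
  apply: contrapT => inf; apply: nex; exists D => k.
  have [B sB leB] := infinite_set_fset k inf.
  exists (take k B); split; first exact/take_uniq/fset_uniq.
    by rewrite size_takel.
  by apply/allP => c /mem_take cB; apply/eqP; apply: sB.
have countR : countable [set: R].
  have -> : [set: R] = \bigcup_(D in [set: nat]) [set x | g x = D].
    by apply/seteqP; split=> // x _; exists (g x).
  apply: bigcup_countable => // D _; exact: finite_set_countable.
have := countable_lebesgue_measure0
  (sub_countable (subset_card_le (@subsetT _ `[0, 1]%classic)) countR).
by rewrite lebesgue_measure_itv /= lte_fin ltr01 sube0 => /eqP; rewrite eqe oner_eq0.
Qed.

Lemma uncountable_Cplx (R : realType) : uncountable (Cplx R).
Proof.
move=> g; have [D hD] := uncountable_real (fun x : R => g (real_complex R x)).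
exists D => k; have [s [uniq_s sz_s /allP gs]] := hD k.
exists (map (real_complex R) s); split; last 1 first.
- by apply/allP => _ /mapP[x xs ->]; apply: gs.
- by rewrite map_inj_uniq //; apply: fmorph_inj.
- by rewrite size_map.
Qed.

(** * Cycles of the Koszul complex in low degree *)

Lemma spanned_delta (A : comNzRingType) (I : finType) (w : I -> A) eta t :
  spanned predT w (delta w eta t).
Proof.
have idw := spanned_ideal predT w.
elim: t eta => [|j t IH] eta /=; first exact: ideal0.
apply: idealB => //; rewrite mulrC; apply: idealM => //; exact: spanned_gen.
Qed.

Lemma mpolyXU_neq0 (A : nzRingType) (n : nat) (i : 'I_n) :
  mpolyX A (mnm1 i) != 0.
Proof.
apply/eqP => /(congr1 (mcoeff (mnm1 i))) /eqP.
by rewrite mcoeffX eqxx mcoeff0 oner_eq0.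
Qed.

Section DegreeBound.
Variables (F : closedFieldType).
Hypothesis uncF : uncountable F.

(** When w has no zero but the origin in an affine space of dimension r > p, a
    p-form eta with w /\ eta = 0 is divisible by w, so it cannot be of smaller
    degree. *)
Theorem delta_cycle_degree (r p d m : nat) (I : finType) (w : I -> mpoly r F)
    (eta : seq I -> mpoly r F) :
  (p < r)%N ->
  (forall i, w i \is @ishomog1 r F d (@mdeg r)) ->
  (forall x : 'I_r -> F, (forall i, meval x (w i) = 0) -> forall j, x j = 0) ->
  (forall t, size t = p -> eta t \is @ishomog1 r F m (@mdeg r)) ->
  (forall t, size t = p.+1 -> delta w eta t = 0) ->
  (exists2 t, size t = p & eta t != 0) -> (d <= m)%N.
Proof.
move=> lt_pr homw w0 hom_eta closed_eta [t0 st0]; apply: contra_neqT.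
rewrite -ltnNge => lt_md.
have [K hK] := homogeneous_nullstellensatz uncF homw w0.
have Xw s : exists u, Xpow F K s = \sum_j u j * w j.
  by have [u ->] := hK s; exists u.
have [|t st|gamma hgamma] :=
    koszul_exact (regular_Xpow (K := K)) Xw (p := p) (s := 0) (eta := eta).
- by rewrite addn0.
- by rewrite closed_eta //; apply: ideal0; apply: spanned_ideal.
have [c] := hgamma t0 st0; rewrite big_pred0 // => /eqP; rewrite subr_eq0 => /eqP e.
rewrite -(pihomog_dE (hom_eta t0 st0)) e.
have [b ->] := spanned_delta w gamma t0.
by rewrite linear_sum big1 //= => i _; apply: pihomogM_lt (homw i).
Qed.

(** If p vanished everywhere, 1 - X_0 p would have no zero, hence would be a unit
    by the Nullstellensatz, i.e. a constant. *)
Lemma mpoly_nonvanishing (n : nat) (p : mpoly n.+1 F) :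
  p != 0 -> exists x, meval x p != 0.
Proof.
move=> p0; pose X := mpolyX F (mnm1 (@ord0 n)).
have X0 : X != 0 by apply: mpolyXU_neq0.
have szXp : (1 < msize (X * p))%N.
  rewrite msizeM // msizeX mdeg1 /=.
  have : msize p != 0%N by rewrite msize_poly_eq0.
  by case: (msize p).
have [||x xJ] :=
    @weak_nullstellensatz F n.+1 uncF (fun f => exists h, f = h * (1 - X * p)).
- split=> [|_ _ [u ->] [v ->]|c _ [u ->]].
  + by exists 0; rewrite mul0r.
  + by exists (u + v); rewrite mulrDl.
  + by exists (c * u); rewrite mulrA.
- case=> h e; have := congr1 (fun f : mpoly n.+1 F => msize f) e.
  have q0 : 1 - X * p != 0.
    by apply/eqP => q0; move/eqP: e; rewrite q0 mulr0 oner_eq0.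
  have h0 : h != 0 by apply/eqP => h0; move/eqP: e; rewrite h0 mul0r oner_eq0.
  rewrite msizeM // msize1.
  have : msize h != 0%N by rewrite msize_poly_eq0.
  have le : (msize (X * p) <=
             maxn (msize (1 : mpoly n.+1 F)) (msize (1 - X * p)))%N.
    rewrite -[in Y in (Y <= _)%N](subKr 1 (X * p)).
    by apply: leq_trans (msizeD_le _ _) _; rewrite mmeasureN.
  move: le szXp; rewrite msize1.
  by move: (msize h) (msize (1 - X * p)) (msize (X * p)) => a b c; lia.
exists x; apply/eqP => px.
have /eqP : meval x (1 - X * p) = 0 by apply: xJ; exists 1; rewrite mul1r.
by rewrite mevalB mevalM px mulr0 subr0 meval1 oner_eq0.
Qed.

End DegreeBound.

Section Substitution.
Variables (F : comNzRingType) (n r : nat) (l : n.-tuple (mpoly r F)).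
Hypothesis homl : forall i, tnth l i \is @ishomog1 r F 1 (@mdeg r).

Lemma comp_mpoly_homog (d : nat) (p : mpoly n F) :
  p \is @ishomog1 n F d (@mdeg n) ->
  comp_mpoly l p \is @ishomog1 r F d (@mdeg r).
Proof.
move=> /dhomogP homp; rewrite comp_mpolyEX big_seq; apply: rpred_sum => m m_p.
apply: rpredZ; rewrite comp_mpolyX -(homp m m_p) /= mdegE.
elim/big_rec2: _ => [|i e q _ homq]; first exact: dhomog1.
by apply: dhomogM => //; rewrite -[X in ishomog1 X]mul1n; apply: dhomogMn.
Qed.

End Substitution.

(** * Linear sections of projective sets *)

Lemma poly_nonroot (F : idomainType) (f : nat -> F) (p : {poly F}) :
  injective f -> p != 0 -> exists k, p.[f k] != 0.
Proof.
move=> f_inj p0; apply: contrapT => nex.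
pose s : seq F := [seq f k | k <- iota 0 (size p)].
have : (size s < size p)%N.
  apply: max_poly_roots => //.
    apply/allP => _ /mapP[k _ ->]; apply/rootP/eqP; apply: contrapT => /negP h.
    by apply: nex; exists k.
  by rewrite map_inj_uniq ?iota_uniq.
by rewrite size_map size_iota ltnn.
Qed.

Section Slicing.
Variables (R : realType) (n : nat).
Local Notation C := (Cplx R).
Local Notation V := 'rV[C]_n.+1.
Local Notation Pol := (mpoly n.+1 C).
Implicit Types (Z W : set V) (S : set Pol).

Lemma pevalM (p q : Pol) (x : V) : peval (p * q) x = peval p x * peval q x.
Proof. exact: mevalM. Qed.

Lemma peval_homog d (p : Pol) (l : C) (x : V) :
  homog d p -> peval p (l *: x) = l ^+ d * peval p x.
Proof.
move=> /dhomogP hp; rewrite /peval !mevalE big_distrr /= big_seq [RHS]big_seq.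
apply: eq_bigr => m mp; rewrite mulrCA; congr (_ * _).
rewrite -(hp m mp) /= mdegE -prodrXr -big_split; apply: eq_bigr => i _ /=.
by rewrite mxE exprMn.
Qed.

Definition vanishing Z : Pol -> Prop := fun f => forall x, Z x -> peval f x = 0.

Lemma vanishing_ideal Z : ideal (vanishing Z).
Proof.
split=> [x _|f g hf hg x Zx|a f hf x Zx]; rewrite /peval.
- exact: meval0.
- by rewrite mevalD [X in X + _]hf // [X in _ + X]hg // addr0.
- by rewrite mevalM [X in _ * X]hf // mulr0.
Qed.

Lemma zeros_setU S S' : zeros (S `|` S') = zeros S `&` zeros S'.
Proof.
apply/seteqP; split=> x /=.
  by case=> x0 h; split; split=> // f Sf; apply: h; [left|right].
by case=> -[x0 h] [_ h']; split=> // f [/h|/h'].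
Qed.

Lemma zariski_closedI Z Z' :
  zariski_closed Z -> zariski_closed Z' -> zariski_closed (Z `&` Z').
Proof.
case=> S hS ->; case=> S' hS' ->; exists (S `|` S'); last by rewrite zeros_setU.
by move=> f [/hS|/hS'].
Qed.

(** Noetherian induction on closed sets: a minimal counterexample is one whose
    vanishing ideal is maximal. *)
Lemma zariski_closed_ind (P : set V -> Prop) :
  (forall Z, zariski_closed Z ->
     (forall Z', zariski_closed Z' -> Z' `<=` Z -> ~ (Z `<=` Z') -> P Z') ->
     P Z) ->
  forall Z, zariski_closed Z -> P Z.
Proof.
move=> step Z0 clZ0; apply: contrapT => nP0.
have [||J [Z [clZ nPZ JE]] maxJ] := @maximal_ideal_in C n.+1
  (fun J => exists Z, [/\ zariski_closed Z, ~ P Z & J = vanishing Z])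
  (vanishing Z0).
- by move=> J [Z [_ _ ->]]; apply: vanishing_ideal.
- by exists Z0.
apply: nPZ; apply: step => // Z' clZ' sZ'Z nsZZ'.
apply: contrapT => nPZ'; apply: nsZZ' => x Zx.
have sub f : vanishing Z' f -> vanishing Z f.
  rewrite -JE; apply: maxJ; first by exists Z'.
  by move=> g; rewrite JE => vg y /sZ'Z; apply: vg.
case: clZ' sub => S _ -> sub; split.
  by case: clZ Zx => S' _ -> [].
by move=> f Sf; apply: sub Zx => y [_]; apply.
Qed.

(** A finite set of points of Z that meets all the irreducible components: all
    that is needed of the decomposition of Z into irreducible components to
    choose a hyperplane containing none of them. *)
Lemma representative_points Z : zariski_closed Z ->
  (Z !=set0 -> exists2 W, zariski_irreducible W & W `<=` Z) /\
  exists2 pts : seq V, (forall x, x \in pts -> Z x) &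
    forall W, zariski_irreducible W -> W `<=` Z ->
      exists W', [/\ zariski_irreducible W', W `<=` W', W' `<=` Z &
                     exists2 x, x \in pts & W' x].
Proof.
elim/zariski_closed_ind => {}Z clZ IH.
case: (pselect (zariski_irreducible Z)) => [irrZ|nirrZ].
  split; first by exists Z.
  have [_ [z Zz] _] := irrZ.
  exists [:: z] => [x|W irrW WZ]; first by rewrite inE => /eqP->.
  by exists Z; split=> //; exists z; rewrite ?inE.
case: (pselect (Z !=set0)) => [Z0|nZ0]; last first.
  split=> //; exists [::] => // W [_ [x Wx] _] WZ.
  by case: nZ0; exists x; apply: WZ.
have [A [B [clA clB ZAB nZA nZB]]] : exists A B,
    [/\ zariski_closed A, zariski_closed B, Z `<=` A `|` B, ~ (Z `<=` A) &
        ~ (Z `<=` B)].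
  apply: contrapT => nex; apply: nirrZ; split=> // A B clA clB ZAB.
  apply: contrapT => /not_orP[nA nB]; apply: nex.
  by exists A, B.
have [||IHA0 [ptsA ptsAZ IHA]] := IH _ (zariski_closedI clZ clA).
- by move=> x [].
- by move=> h; apply: nZA => x /h[].
have [||IHB0 [ptsB ptsBZ IHB]] := IH _ (zariski_closedI clZ clB).
- by move=> x [].
- by move=> h; apply: nZB => x /h[].
split.
  move=> _; have [z Zz] := Z0; have [Az|Bz] := ZAB z Zz.
    by have [|W irrW WZ] := IHA0; [exists z|exists W => // x /WZ[]].
  by have [|W irrW WZ] := IHB0; [exists z|exists W => // x /WZ[]].
exists (ptsA ++ ptsB) => [x|W irrW WZ].
  by rewrite mem_cat => /orP[/ptsAZ|/ptsBZ] [].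
have [_ _ /(_ A B clA clB (subset_trans WZ ZAB))[WA|WB]] := irrW.
  have [|W' [irrW' WW' W'Z [x x_pts W'x]]] := IHA W irrW.
    by move=> x Wx; split; [exact: WZ|exact: WA].
  exists W'; split=> //; first by move=> y /W'Z[].
  by exists x; rewrite // mem_cat x_pts.
have [|W' [irrW' WW' W'Z [x x_pts W'x]]] := IHB W irrW.
  by move=> x Wx; split; [exact: WZ|exact: WB].
exists W'; split=> //; first by move=> y /W'Z[].
by exists x; rewrite // mem_cat x_pts orbT.
Qed.

Lemma codim_ge_full Z : zariski_closed Z -> codim_ge Z n.+1 -> Z = set0.
Proof.
move=> /representative_points[exW _] codimZ.
apply/seteqP; split=> // x Zx; have [|W irrW WZ] := exW; first by exists x.
have := @codimZ 0 (fun=> W); rewrite add0n ltnn => /(_ _ _)/notF; apply => //.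
Qed.

Definition linform (u : V) : Pol := \sum_j u 0 j *: mpolyX C (mnm1 j).

Lemma linformE u x : peval (linform u) x = \sum_j u 0 j * x 0 j.
Proof.
rewrite /peval /linform raddf_sum; apply: eq_bigr => j _ /=.
by rewrite mevalZ mevalXU.
Qed.

Lemma linform_homog u : homog 1 (linform u).
Proof.
apply: rpred_sum => j _; apply: rpredZ.
by rewrite dhomogX /= mdeg1.
Qed.

(** The hyperplanes through x0 are spanned by x0_(j0) X_i - x0_i X_(j0), where
    x0_(j0) is not 0.  The value at z of the combination of these with
    coefficients t ^ i is a polynomial in t, nonzero as z is not proportional
    to x0; so a value of t suits all the given points z. *)
Lemma avoiding_hyperplane (x0 : V) (pts : seq V) : x0 != 0 ->
  (forall z, z \in pts -> forall l, z <> l *: x0) ->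
  exists u : V, \sum_j u 0 j * x0 0 j = 0 /\
    forall z, z \in pts -> \sum_j u 0 j * z 0 j != 0.
Proof.
move=> /rV0Pn[j0 x00] npts.
pose h (z : V) i := x0 0 j0 * z 0 i - x0 0 i * z 0 j0.
pose p z : {poly C} := \sum_(i < n.+1) (h z i)%:P * 'X^i.
pose u (t : C) : V := \row_(j < n.+1)
  (t ^+ j * x0 0 j0 - (\sum_(i < n.+1) t ^+ i * x0 0 i) * (j == j0)%:R).
have uE (t : C) (z : V) : \sum_j u t 0 j * z 0 j = (p z).[t].
  rewrite /p horner_sum; transitivity (\sum_(j < n.+1) (t ^+ j * x0 0 j0 * z 0 j
      - (\sum_(i < n.+1) t ^+ i * x0 0 i) * (j == j0)%:R * z 0 j)).
    by apply: eq_bigr => j _; rewrite mxE mulrBl.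
  transitivity (\sum_(i < n.+1)
      (x0 0 j0 * z 0 i * t ^+ i - x0 0 i * z 0 j0 * t ^+ i)).
    rewrite !sumrB; congr (_ - _); first by apply: eq_bigr => i _; ring.
    rewrite (bigD1 j0) //= eqxx mulr1 [X in _ + X]big1 ?addr0 => [|i /negPf->].
      by rewrite big_distrl; apply: eq_bigr => i _ /=; ring.
    by rewrite mulr0 mul0r.
  by apply: eq_bigr => i _; rewrite hornerM hornerC hornerXn /h mulrBl.
have p0 : \prod_(z <- pts) p z != 0.
  rewrite prodf_seq_neq0; apply/allP => z zpts; apply/eqP => pz0.
  apply: (npts z zpts (z 0 j0 / x0 0 j0)); apply/rowP => i; rewrite mxE.
  have := congr1 (fun q : {poly C} => q`_i) pz0.
  rewrite coef0 coef_sum (bigD1 i) //= big1 => [|i' ne].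
    rewrite coefCM coefXn eqxx mulr1 addr0 /h => /eqP; rewrite subr_eq0 => /eqP e.
    by rewrite mulrAC -[z 0 j0 * _]mulrC -e mulrAC mulfV // mul1r.
  rewrite coefCM coefXn -(inj_eq val_inj) /= eq_sym in ne *.
  by rewrite (negPf ne) mulr0.
have nat_inj : injective (fun k : nat => k%:R : C).
  by move=> a b /eqP; rewrite eqr_nat => /eqP.
have [k pk] := poly_nonroot nat_inj p0.
exists (u k%:R); split.
  rewrite uE /p horner_sum big1 // => i _.
  by rewrite /h [x0 0 i * _]mulrC subrr mul0r horner0.
move=> z zpts; rewrite uE; apply: contraNneq pk => pz.
by rewrite horner_prod (big_rem z) //= pz mul0r.
Qed.

(** If the hyperplane contains no irreducible component of the zero locus, a
    chain of irreducible closed subsets of the section can be extended by a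
    component of the locus.  That it passes through x0 is required in order to
    cut repeatedly without losing a point where a given form does not vanish. *)
Lemma hyperplane_section S c (x0 : V) :
  (forall f, S f -> exists d, homog d f) -> x0 != 0 -> ~ zeros S x0 ->
  codim_ge (zeros S) c ->
  exists u : V, \sum_j u 0 j * x0 0 j = 0 /\
    codim_ge (zeros (S `|` [set linform u])) c.+1.
Proof.
move=> homS x00 nSx0 codimS.
have [|_ [pts ptsS repr]] := @representative_points (zeros S); first by exists S.
have [|u [ux0 upts]] := @avoiding_hyperplane x0 pts x00.
  move=> z /ptsS[z0 Sz] l zE; apply: nSx0; split=> // f Sf.
  have [d hd] := homS f Sf.
  have l0 : l != 0 by apply: contraNneq z0 => l0; rewrite zE l0 scale0r.
  have /eqP := Sz f Sf; rewrite zE (peval_homog _ _ hd) mulf_eq0 expf_eq0.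
  by rewrite (negPf l0) andbF => /eqP.
exists u; split=> // d W irrW ltW; rewrite addnS -addSn.
have [irrWd WdZ] := irrW d (leqnn d).
have zsub : zeros (S `|` [set linform u]) `<=` zeros S.
  by rewrite zeros_setU => x [].
have [W' [irrW' WW' W'S [x xpts W'x]]] := repr _ irrWd (subset_trans WdZ zsub).
apply: (codimS d.+1 (fun i => if (i <= d)%N then W i else W')) => i.
  move=> _ /=; case: ifP => // le_id; have [irrWi WiZ] := irrW i le_id.
  by split=> //; apply: subset_trans zsub.
move=> lt_id1; have {lt_id1} [->|lt_id] /= : (i = d \/ i < d)%N by lia.
  2: by rewrite (ltnW lt_id) lt_id; apply: ltW.
rewrite leqnn ltnn; split=> // W'W.
have [_ /(_ (linform u))] := WdZ _ (W'W _ W'x).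
by rewrite linformE => h; have /eqP := upts x xpts; apply; apply: h; right.
Qed.

Lemma disjoint_linear_subspace S c (x0 : V) :
  (forall f, S f -> exists d, homog d f) -> x0 != 0 -> ~ zeros S x0 ->
  (c <= n.+1)%N -> codim_ge (zeros S) c ->
  exists U : 'M[C]_(n.+1 - c, n.+1), x0 *m U^T = 0 /\
    forall x, zeros S x -> x *m U^T <> 0.
Proof.
move=> homS x00 nSx0 le_c codimS.
have [k kE] : exists k, (n.+1 - c = k)%N by exists (n.+1 - c)%N.
rewrite kE; elim: k c S kE homS nSx0 le_c codimS =>
  [|k IH] c S kE homS nSx0 le_c codimS.
  exists 0; split; first by rewrite trmx0 mulmx0.
  have ec : c = n.+1 by lia.
  by move=> x Sx; rewrite (@codim_ge_full (zeros S)) // -?ec // in Sx; exists S.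
have [u [ux0 codimSu]] := hyperplane_section homS x00 nSx0 codimS.
have [||||U [Ux0 US]] := IH c.+1 (S `|` [set linform u]) _ _ _ _ codimSu.
- by lia.
- by move=> f [/homS//|->]; exists 1; apply: linform_homog.
- by rewrite zeros_setU => -[].
- by lia.
have uE (x : V) : (x *m u^T) 0 0 = \sum_j u 0 j * x 0 j.
  by rewrite mxE; apply: eq_bigr => j _; rewrite mxE mulrC.
have mulE (x : V) : x *m (col_mx u U)^T = row_mx (x *m u^T) (x *m U^T).
  by rewrite tr_col_mx mul_mx_row.
exists (col_mx u U); split=> [|x Sx].
  apply: etrans (mulE x0) _; rewrite Ux0 [X in row_mx X _](_ : _ = 0) ?row_mx0 //.
  by apply/rowP => i; rewrite ord1 uE ux0 mxE.
move/(etrans (esym (mulE x)))/eqP; rewrite row_mx_eq0 => /andP[/eqP ux /eqP Ux].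
apply: (US x) => //; rewrite zeros_setU; split=> //.
by case: Sx => x_neq0 _; split=> // _ ->; rewrite linformE -uE ux mxE.
Qed.

End Slicing.

(** * Division of forms and degrees *)

Section Bound.
Variables (R : realType) (n : nat).
Local Notation C := (Cplx R).
Local Notation V := 'rV[C]_n.+1.
Local Notation Pol := (mpoly n.+1 C).

Lemma peval_nonvanishing (p : Pol) : p != 0 ->
  exists2 x : V, x != 0 & peval p x != 0.
Proof.
move=> p0.
(* The factor X_0 excludes the origin. *)
have [x] := mpoly_nonvanishing (@uncountable_Cplx R)
  (mulf_neq0 (mpolyXU_neq0 C (@ord0 n)) p0).
rewrite mevalM mevalXU mulf_eq0 negb_or => /andP[x0 px].
exists (\row_j x j); last first.
  by rewrite /peval (@meval_eq _ _ _ x) // => i; rewrite mxE.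
by apply: contraNneq x0 => /rowP/(_ ord0); rewrite !mxE => ->.
Qed.

Lemma delta_rmorph (A B : comNzRingType) (f : {rmorphism A -> B}) (I : finType)
    (w : I -> A) eta t :
  f (delta w eta t) = delta (f \o w) (f \o eta) t.
Proof.
elim: t eta => [|j t IH] eta /=; first exact: rmorph0.
by rewrite rmorphB rmorphM IH.
Qed.

(** The degree estimate of the division lemma.  The coefficients are restricted
    to a linear subspace L of dimension r > q, parametrised by a row-free matrix
    G, that contains a point where eta is not zero and no zero of w. *)
Theorem cycle_degree_bound (q d m : nat) (w : 'I_n.+1 -> Pol)
    (eta : seq 'I_n.+1 -> Pol) :
  (q <= n)%N -> (forall j, homog d (w j)) -> (exists j, w j != 0) ->
  codim_ge (zeros (range w)) q.+1 ->
  (forall t, size t = q -> homog m (eta t)) ->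
  (forall t, size t = q.+1 -> delta w eta t = 0) ->
  (exists2 t, size t = q & eta t != 0) -> (d <= m)%N.
Proof.
move=> le_qn homw [j0 wj0] codimw hom_eta closed_eta [t0 st0 eta0].
have [x0 x00] := peval_nonvanishing (mulf_neq0 wj0 eta0).
rewrite pevalM mulf_eq0 negb_or => /andP[wx0 etax0].
have [|||U [Ux0 Uw]] :=
    @disjoint_linear_subspace R n (range w) q.+1 x0 _ x00 _ _ codimw.
- by move=> _ [j _ <-]; exists d.
- by case=> _ /(_ (w j0)) h; move/eqP: wx0; apply; apply: h; exists j0.
- by [].
(* L is the row space of G, and l substitutes y *m G for the coordinates. *)
pose K := kermx U^T; pose G := row_base K; pose r := \rank K.
have lt_qr : (q < r)%N.
  rewrite /r /K mxrank_ker; have := rank_leq_col U^T; lia.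
pose l := [tuple \sum_(i < r) G i j *: mpolyX C (mnm1 i) | j < n.+1].
have homl j : tnth l j \is @ishomog1 r C 1 (@mdeg r).
  rewrite tnth_mktuple; apply: rpred_sum => i _; apply: rpredZ.
  by rewrite dhomogX /= mdeg1.
have evl (y : 'rV[C]_r) (p : Pol) :
    meval (fun i => y 0 i) (comp_mpoly l p) = peval p (y *m G).
  rewrite comp_mpoly_meval; apply: meval_eq => j.
  rewrite tnth_mktuple raddf_sum mxE; apply: eq_bigr => i _ /=.
  by rewrite mevalZ mevalXU mulrC.
apply: (@delta_cycle_degree C (@uncountable_Cplx R) r q d m _
  (comp_mpoly l \o w) (comp_mpoly l \o eta) lt_qr).
- by move=> j; apply: (comp_mpoly_homog homl); apply: homw.
- move=> y wy; pose y' := \row_i y i; have y'E i : y' 0 i = y i by rewrite mxE.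
  suff y'0 : y' = 0 by move=> i; rewrite -y'E y'0 mxE.
  apply: contrapT => /eqP y'0; apply: (Uw (y' *m G)).
    split; first by rewrite mulmx_free_eq0 ?row_base_free.
    move=> _ [j _ <-]; rewrite -evl -[RHS](wy j); exact: meval_eq.
  have : (y' *m G <= K)%MS by rewrite (submx_trans (submxMl _ _)) // eq_row_base.
  by move/sub_kermxP.
- by move=> t st; apply/(comp_mpoly_homog homl)/hom_eta.
- by move=> t st; rewrite -delta_rmorph closed_eta // rmorph0.
- exists t0 => //; apply: contraNneq etax0 => e.
  have : (x0 <= G)%MS by rewrite eq_row_base; apply/sub_kermxP.
  by case/submxP => y ->; rewrite -evl [comp_mpoly _ _]e meval0.
Qed.

End Bound.

(** * Wedge products and contractions as determinants *)

Section DeltaDeterminant.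
Variable A : comNzRingType.

Lemma delta_expansion (I : finType) (w : I -> A) q (f : 'I_q.+1 -> I) eta :
  delta w eta [seq f i | i <- enum 'I_q.+1] =
  \sum_(i < q.+1) (-1) ^+ i * w (f i) *
     eta [seq f (lift i b) | b <- enum 'I_q].
Proof.
elim: q f eta => [|q IH] f eta; rewrite enum_ordSl /=.
  have -> : enum 'I_0 = [::] by apply: size0nil; rewrite size_enum_ord.
  by rewrite big_ord1 expr0 mul1r subr0.
rewrite -map_comp big_ord_recl expr0 mul1r; congr (_ + _).
rewrite (IH (f \o lift ord0)) -sumrN; apply: eq_bigr => i _ /=.
rewrite exprS !mulN1r !mulNr; congr (- (_ * eta _)).
rewrite [in RHS]enum_ordSl /= -map_comp; congr (f _ :: _); first exact: val_inj.
by apply: eq_map => b /=; congr f; apply: val_inj; rewrite /= !bumpS.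
Qed.

Variable N : nat.
Implicit Types (v : 'rV[A]_N).

(** A form is extended by 0 to the lists of the wrong length. *)
Definition formseq k (w : form A N k) (s : seq 'I_N) : A := oapp w 0 (insub s).

Lemma formseqE k (w : form A N k) (t : k.-tuple 'I_N) : formseq w t = w t.
Proof. by rewrite /formseq valK. Qed.

Definition bordered q (v : 'I_N -> A) (E : 'I_q -> 'rV[A]_N) (f : 'I_q.+1 -> 'I_N) :
  'M[A]_q.+1 :=
  \matrix_(i, j) if unlift ord0 i is Some c then E c 0 (f j) else v (f j).

Lemma delta_wedge q (v : 'I_N -> A) (E : 'I_q -> 'rV[A]_N) (f : 'I_q.+1 -> 'I_N) :
  delta v (formseq (wedge E)) [seq f i | i <- enum 'I_q.+1] = \det (bordered v E f).
Proof.
rewrite delta_expansion (expand_det_row _ ord0); apply: eq_bigr => i _.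
rewrite mxE unlift_none mulrAC mulrC /cofactor add0n; congr (_ * (_ * _)).
have -> : [seq f (lift i b) | b <- enum 'I_q] = [tuple f (lift i b) | b < q] by [].
rewrite formseqE ffunE; congr (\det _); apply/matrixP => a b.
by rewrite !mxE liftK tnth_mktuple.
Qed.

(** E_a /\ E_1 /\ ... /\ E_q = 0, as a determinant with two equal rows. *)
Lemma delta_wedge_self q (E : 'I_q -> 'rV[A]_N) a (s : seq 'I_N) :
  size s = q.+1 -> delta (E a 0) (formseq (wedge E)) s = 0.
Proof.
move=> /eqP sz_s; have -> : s = [seq tnth (Tuple sz_s) i | i <- enum 'I_q.+1].
  by rewrite map_tnth_enum.
rewrite delta_wedge.
apply: (determinant_alternate (i1 := ord0) (i2 := lift ord0 a)) => // j.
by rewrite !mxE unlift_none liftK.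
Qed.

(** The vector field on which a 1-form w takes the value (w /\ eta)(s); see
    delta_plucker.  Where eta is decomposable and not 0, these fields span its
    kernel. *)
Definition plucker (eta : seq 'I_N -> A) (s : seq 'I_N) : 'rV[A]_N :=
  \row_j delta (fun i => (i == j)%:R) eta s.

Lemma delta_plucker (w : 'I_N -> A) eta s :
  delta w eta s = \sum_j plucker eta s 0 j * w j.
Proof.
elim: s eta => [|i s IH] eta /=.
  by rewrite big1 // => j _; rewrite mxE mul0r.
rewrite IH; under [RHS]eq_bigr do rewrite mxE /= mulrBl.
rewrite sumrB; congr (_ - _); last by apply: eq_bigr => j _; rewrite mxE.
rewrite (bigD1 i) //= eqxx mul1r mulrC big1 ?addr0 // => j /negPf ji.
by rewrite eq_sym ji !mul0r.
Qed.

Lemma contract_wedge k v (E : 'I_k.+1 -> 'rV[A]_N) (t : k.-tuple 'I_N) :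
  contract v (wedge E) t = \det (\matrix_(a < k.+1, b < k.+1)
    if unlift ord0 b is Some b' then E a 0 (tnth t b')
    else \sum_j v 0 j * E a 0 j).
Proof.
rewrite ffunE (expand_det_col _ ord0).
under [RHS]eq_bigr do rewrite mxE unlift_none big_distrl /=.
rewrite exchange_big /=; apply: eq_bigr => j _.
rewrite ffunE (expand_det_col _ ord0) big_distrr /=; apply: eq_bigr => a _.
rewrite mxE tnth0 mulrA; congr (_ * _); rewrite /cofactor; congr (_ * \det _).
by apply/matrixP => a' b; rewrite !mxE liftK tnthS.
Qed.

Lemma contract_wedge0 k v (E : 'I_k -> 'rV[A]_N) :
  (forall a, \sum_j v 0 j * E a 0 j = 0) -> contract v (wedge E) = 0.
Proof.
case: k E => [|k] E vE; apply/ffunP => t; rewrite [RHS]ffunE; first by rewrite ffunE.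
rewrite contract_wedge (expand_det_col _ ord0) big1 // => a _.
by rewrite mxE unlift_none vE mul0r.
Qed.

End DeltaDeterminant.

(** Cramer's rule: if a maximal minor M of E is not 0 and i_v E = 0, then
    replacing any column of M by the vector of the E_a(v) gives determinant 0,
    that is adj M kills this vector. *)
Lemma contract_wedge_eq0 (A : idomainType) N k (v : 'rV[A]_N)
    (E : 'I_k.+1 -> 'rV[A]_N) :
  wedge E <> 0 -> contract v (wedge E) = 0 ->
  forall a, \sum_j v 0 j * E a 0 j = 0.
Proof.
move=> E0 vE.
have [t Et] : exists t, wedge E t != 0.
  apply: contrapT => nex; apply: E0; apply/ffunP => t; rewrite [RHS]ffunE.
  by apply/eqP; apply: contrapT => /negP h; apply: nex; exists t.
pose M := \matrix_(a < k.+1, b < k.+1) E a 0 (tnth t b).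
have detM : \det M != 0 by rewrite ffunE in Et.
pose c : 'cV[A]_k.+1 := \col_a \sum_j v 0 j * E a 0 j.
have adjc : \adj M *m c = 0.
  apply/colP => b; rewrite mxE mxE.
  have /ffunP/(_ [tuple tnth t (lift b b') | b' < k]) := vE.
  rewrite contract_wedge (expand_det_col _ ord0) ffunE => e.
  transitivity ((-1) ^+ b * 0 : A); last by rewrite mulr0.
  rewrite -[in RHS]e big_distrr /=; apply: eq_bigr => a _.
  set L := \matrix_(_ < _, _ < _) _.
  have cofE : cofactor M a b = (-1) ^+ b * cofactor L a ord0.
    rewrite /cofactor mulrA -exprD addn0 addnC; congr (_ * \det _).
    by apply/matrixP => a' b'; rewrite !mxE liftK tnth_mktuple.
  have L0 : L a ord0 = c a 0 by rewrite !mxE unlift_none.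
  by rewrite [X in X * _]mxE cofE L0; ring.
move=> a; have /colP/(_ a) : \det M *: c = 0.
  by rewrite -mul_scalar_mx -mul_mx_adj -mulmxA adjc mulmx0.
by rewrite !mxE => /eqP; rewrite mulf_eq0 (negPf detM) => /eqP.
Qed.

(** * Distributions and flags *)

Section Flags.
Variables (R : realType) (n : nat).
Local Notation C := (Cplx R).
Local Notation V := 'rV[C]_n.+1.
Local Notation Pol := (mpoly n.+1 C).

Lemma differentiable_peval (p : Pol) (x : V) : differentiable (peval p) x.
Proof.
elim/mpoly_ring_ind: p => [c|i|p q dp dq|p q dp dq].
- rewrite (_ : peval _ = cst c); first exact: differentiable_cst.
  by apply/funext => y; rewrite /peval mevalC.
- rewrite (_ : peval _ = (fun y : V => y 0 i)); first exact: differentiable_coord.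
  by apply/funext => y; rewrite /peval mevalXU.
- rewrite (_ : peval _ = peval p + peval q); first exact: differentiableD.
  by apply/funext => y; rewrite /peval mevalD.
- rewrite (_ : peval _ = peval p * peval q); first exact: differentiableM.
  by apply/funext => y; rewrite /peval mevalM.
Qed.

Lemma differentiable_row (f : 'I_n.+1 -> V -> C) (x : V) :
  (forall j, differentiable (f j) x) ->
  differentiable (fun y => \row_j f j y : V) x.
Proof.
move=> df; rewrite (_ : (fun y => _) = \sum_j (fun y => f j y *: delta_mx 0 j)).
  by apply: differentiable_sum => j; apply: differentiableZl.
apply/funext => y; rewrite fct_sumE; apply/rowP => i.
rewrite summxE mxE (bigD1 i) //= !mxE !eqxx mulr1 big1 ?addr0 // => j ji.
by rewrite !mxE eq_sym (negPf ji) mulr0.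
Qed.

Lemma open_neq0 : open [set y : C | y != 0].
Proof.
have -> : [set y : C | y != 0] = ~` [set 0] by apply/seteqP; split=> y /= /eqP.
exact/closed_openC/accessible_closed_set1/hausdorff_accessible/norm_hausdorff.
Qed.

Lemma conic_open_chart (i : 'I_n.+1) : conic_open [set x : V | x 0 i != 0].
Proof.
split=> [||l x l0 /= xi]; first last.
- by rewrite mxE mulf_neq0.
- by rewrite /= mxE eqxx.
have -> : [set x : V | x 0 i != 0] = (fun x : V => x 0 i) @^-1` [set y | y != 0] by [].
apply: open_comp; first by move=> x _; apply: coord_continuous.
exact: open_neq0.
Qed.

Definition peval_row (X : 'rV[Pol]_n.+1) (x : V) : V := \row_j peval (X 0 j) x.

Lemma feval_wedge k (om : 'I_k -> 'rV[Pol]_n.+1) (x : V) :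
  feval (wedge om) x = wedge (fun a => peval_row (om a) x).
Proof.
apply/ffunP => t; rewrite !ffunE /peval -det_map_mx; congr (\det _).
by apply/matrixP => a b; rewrite !mxE.
Qed.

Lemma feval_contract k (X : 'rV[Pol]_n.+1) (w : form Pol n.+1 k) (x : V) :
  feval (contract X w) x = contract (peval_row X x) (feval w x).
Proof.
case: k w => [|k] w; apply/ffunP => t; rewrite !ffunE; first exact: meval0.
rewrite /peval raddf_sum; apply: eq_bigr => j _ /=.
by rewrite mevalM mxE ffunE.
Qed.

Lemma peval_plucker k (w : form Pol n.+1 k) (s : seq 'I_n.+1) (x : V) :
  peval_row (plucker (formseq w) s) x = plucker (formseq (feval w x)) s.
Proof.
apply/rowP => j; rewrite !mxE /peval delta_rmorph; transitivity
  (delta (fun i => (i == j)%:R) (fun s => meval (fun i => x 0 i) (formseq w s)) s).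
  elim: s {w}(formseq w) => //= i s IH eta; rewrite IH; congr (_ * _ - _).
  by rewrite rmorph_nat.
apply: eq_delta => t _; rewrite /formseq; case: insub => [u|] /=;
  last exact: meval0.
by rewrite ffunE.
Qed.

Lemma contractZ (A : comNzRingType) N k (c : A) (v : 'rV[A]_N) (w : form A N k) :
  contract (c *: v) w = [ffun t => c * contract v w t].
Proof.
case: k w => [|k] w; apply/ffunP => t; rewrite !ffunE ?mulr0 // big_distrr.
by apply: eq_bigr => j _ /=; rewrite mxE mulrA.
Qed.

Lemma contract_form0 (A : comNzRingType) N k (v : 'rV[A]_N) :
  contract v (0 : form A N k) = 0.
Proof.
case: k => [|k]; apply/ffunP => t; rewrite !ffunE // big1 // => j _.
by rewrite ffunE mulr0.
Qed.

(** The Pluecker relations hold where the form is decomposable, and trivially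
    where it vanishes. *)
Lemma plucker_kernel q (D : distribution R n q) (s : seq 'I_n.+1) (x : V) :
  x != 0 -> size s = q.+1 ->
  contract (plucker (formseq (feval (dform D) x)) s) (feval (dform D) x) = 0.
Proof.
move=> x0 sz_s; case: (pselect (fsing (dform D) x)) => [[_ ->]|nsing].
  exact: contract_form0.
have [U [E [_ Ux _ /(_ x Ux) ->]]] := dform_decomposable x0 nsing.
apply: contract_wedge0 => a; rewrite -delta_plucker.
exact: delta_wedge_self.
Qed.

(** Sections of O(1)^(n+1) are homogeneous of degree 1, while the field has
    degree deg D + 1; dividing by a power of a coordinate corrects this, at the
    price of working on a standard chart. *)
Lemma plucker_section q (D : distribution R n q) (s : seq 'I_n.+1) (i : 'I_n.+1) :
  size s = q.+1 ->
  tangent_sheaf D [set x : V | x 0 i != 0]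
    (fun x => (x 0 i)^-1 ^+ deg D *: peval_row (plucker (formseq (dform D)) s) x).
Proof.
move=> sz_s; set X := plucker _ _; split=> [|x xi].
  split=> [x xi|l x l0 xi].
    rewrite (_ : (fun y : V => _) =
        fun y : V => \row_j ((y 0 i)^-1 ^+ deg D * peval (X 0 j) y)); last first.
      by apply/funext => y; apply/rowP => j; rewrite !mxE.
    apply: differentiable_row => j.
    apply: differentiableM (differentiable_peval _ _).
    have dV : differentiable (fun y : V => (y 0 i)^-1) x.
      by apply: differentiableV => //; apply: differentiable_coord.
    case: (deg D) => [|e]; first exact: differentiable_cst.
    by rewrite -(exprfctE (fun y : V => (y 0 i)^-1)); apply: differentiableX.
  have homX j : homog (deg D).+1 (X 0 j).
    rewrite mxE; apply: (@delta_closed _ _ _ (fun f => homog (deg D).+1 f)).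
    - exact: dhomog0.
    - by move=> f g; apply: rpredB.
    - by move=> i' f hf; rewrite mulr_natl; apply: rpredMn.
    - rewrite sz_s => t /= st; rewrite /formseq; case: insubP => [u _ _|_] /=.
        exact: dform_homog.
      exact: dhomog0.
  clearbody X; apply/rowP => j; rewrite !mxE (peval_homog _ _ (homX j)).
  rewrite invfM exprMn exprS.
  have ll : l^-1 ^+ deg D * l ^+ deg D = 1 by rewrite -exprMn mulVf ?expr1n.
  rewrite -[RHS]mul1r -ll; ring.
rewrite contractZ peval_plucker plucker_kernel //; last first.
  by apply: contraNneq xi => ->; rewrite mxE.
by apply/ffunP => t; rewrite !ffunE mulr0.
Qed.

Lemma form_neq0 (A : comNzRingType) N k (w : form A N k) :
  w <> 0 -> exists t, w t != 0.
Proof.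
move=> w0; apply: contrapT => nex; apply: w0; apply/ffunP => t.
by rewrite [RHS]ffunE; apply/eqP; apply: contrapT => /negP h; apply: nex; exists t.
Qed.

Lemma wedge_factor_neq0 (A : comNzRingType) N k (om : 'I_k -> 'rV[A]_N) a :
  wedge om <> 0 -> exists j, om a 0 j != 0.
Proof.
move=> /form_neq0[t /eqP om0]; apply: contrapT => nex; apply: om0.
rewrite ffunE (expand_det_row _ a) big1 // => b _; rewrite mxE.
suff -> : om a 0 (tnth t b) = 0 by rewrite mul0r.
by apply/eqP; apply: contrapT => /negP h; apply: nex; exists (tnth t b).
Qed.

Section FlagDegree.
Variables (q k : nat) (D : distribution R n q) (G : distribution R n k.+1).
Variable om : 'I_k.+1 -> 'rV[Pol]_n.+1.
Hypotheses (flagDG : flag D G) (G_om : dform G = wedge om).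

Lemma wedge_om_neq0 : wedge om <> 0.
Proof. by rewrite -G_om; apply: dform_neq0. Qed.

Lemma flag_annihilates a (s : seq 'I_n.+1) : size s = q.+1 ->
  delta (om a 0) (formseq (dform D)) s = 0.
Proof.
move=> sz_s; rewrite delta_plucker; set X := plucker _ _.
apply: contract_wedge_eq0; first exact: wedge_om_neq0.
apply: contrapT => /form_neq0[t /peval_nonvanishing[x x0]].
have /rV0Pn[i xi] := x0; apply/negP; rewrite negbK.
have [_ /(_ _ (conic_open_chart i) _ (plucker_section D i sz_s))] := flagDG.
case=> _ /(_ x xi).
rewrite -/X contractZ G_om -feval_contract => /ffunP/(_ t).
by rewrite !ffunE => /eqP; rewrite mulf_eq0 expf_eq0 invr_eq0 (negPf xi) andbF.
Qed.

Lemma sing_zeros l (H : distribution R n l) :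
  Sing H = zeros (range (dform H)).
Proof.
apply/seteqP; split=> x [x0 h]; split=> //.
  by move=> _ [t _ <-]; have /ffunP/(_ t) := h; rewrite !ffunE.
by apply/ffunP => t; rewrite !ffunE; apply: h; exists t.
Qed.

Lemma sing_closed l (H : distribution R n l) : zariski_closed (Sing H).
Proof.
rewrite sing_zeros; exists (range (dform H)) => // _ [t _ <-].
by exists (deg H).+1; apply: dform_homog.
Qed.

Lemma codim_geS (Z Z' : set V) c : Z `<=` Z' -> codim_ge Z' c -> codim_ge Z c.
Proof.
move=> ZZ' codim' d W irrW; apply: codim' => i /irrW[irr WZ].
by split=> //; apply: subset_trans ZZ'.
Qed.

(** A common zero of the coefficients of omega_a is a zero of the wedge product,
    so the codimension hypothesis on Sing G applies to omega_a alone. *)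
Theorem factor_degree_le d a : homog_oneform d (om a) ->
  codim_ge (Sing G) (n - dist_dim D + 1)%N -> (d <= deg D + 1)%N.
Proof.
move=> homa codimG; rewrite addn1.
have lt_qn : (q < n)%N.
  rewrite ltnNge; apply/negP => le_nq.
  have [x] := dform_sing G; rewrite -/(Sing G) (codim_ge_full (sing_closed G)) //.
  by move: codimG; rewrite /dist_dim (_ : _ + 1 = n.+1)%N //; lia.
have cE : (n - dist_dim D + 1 = q.+1)%N by rewrite /dist_dim; lia.
rewrite cE in codimG.
apply: (@cycle_degree_bound R n q d (deg D).+1 (om a 0) (formseq (dform D))) => //.
- exact: ltnW.
- exact: wedge_factor_neq0 wedge_om_neq0.
- apply: codim_geS codimG => x [x0 omx]; split=> //.
  rewrite G_om feval_wedge; apply: contrapT => /(wedge_factor_neq0 a)[j].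
  by rewrite mxE omx ?eqxx //; exists j.
- move=> t st; rewrite /formseq; case: insubP => [u _ _|_] /=.
    exact: dform_homog.
  exact: dhomog0.
- exact: flag_annihilates.
- have [t t0] := form_neq0 (dform_neq0 (d := D)).
  by exists t; rewrite ?size_tuple // formseqE.
Qed.

Lemma degree_sum (d : 'I_k.+1 -> nat) :
  (forall i, homog_oneform (d i) (om i)) -> ((deg G).+1 = \sum_i d i)%N.
Proof.
move=> homom; have [t t0] := form_neq0 wedge_om_neq0.
apply: (dhomog_uniq t0); first by rewrite -G_om; apply: dform_homog.
rewrite ffunE; apply: rpred_sum => s _.
have hom_prod : homog (\sum_i d i)
    (\prod_i (\matrix_(a, b) om a 0 (tnth t b)) i (s i)).
  elim/big_rec2: _ => [|i e f _ homf]; first exact: dhomog1.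
  by apply: dhomogM => //; rewrite mxE; apply: homom.
by case: (odd_perm s); rewrite ?expr1 ?mulN1r ?rpredN // expr0 mul1r.
Qed.

End FlagDegree.

Lemma line_cvg (x u : V) :
  (fun t : C => x + t *: u) t @[t --> (0 : C)] --> x.
Proof.
have cvg_tu : (fun t : C => t *: u) t @[t --> (0 : C)] --> (0 : C) *: u.
  exact: (@cvgZr_tmp C V C (nbhs (0 : C)) _ id 0 u (@cvg_id _ (nbhs (0 : C)))).
have := @cvgD C V C _ _ (cst x) (fun t => t *: u) x _ (cvg_cst x) cvg_tu.
by rewrite scale0r addr0 => cvg_xtu; exact: cvg_xtu.
Qed.

(** On the line from x to a point z where p is not 0, p restricts to a nonzero
    polynomial in one variable, which is not 0 at some of the infinitely many
    points close to x. *)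
Lemma dense_nonvanishing (p : Pol) (x : V) (N : set V) :
  p != 0 -> nbhs x N -> exists2 y, N y & peval p y != 0.
Proof.
move=> /peval_nonvanishing[z _ pz] Nx.
pose L : {poly C} :=
  mmap (@polyC C) (fun i => (x 0 i)%:P + (z 0 i - x 0 i)%:P * 'X) p.
have LE t : L.[t] = peval p (x + t *: (z - x)).
  rewrite /L /mmap /peval mevalE horner_sum; apply: eq_bigr => m _.
  rewrite hornerM hornerC horner_prod; congr (_ * _); apply: eq_bigr => i _.
  by rewrite horner_exp hornerD hornerM !hornerC hornerX !mxE mulrC.
have L0 : L != 0.
  apply: contraNneq pz => L0; have := LE 1.
  by rewrite L0 horner0 scale1r addrC subrK => <-.
have /nbhs_ballP[e /= e0 he] := @line_cvg x (z - x) _ Nx.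
(* Infinitely many parameters of absolute value less than e. *)
have inj : injective (fun k : nat => e / k.+2%:R).
  move=> a b /(mulfI (lt0r_neq0 e0))/invr_inj/eqP; rewrite eqr_nat.
  by move/eqP => [].
have [k Lk] := poly_nonroot inj L0.
exists (x + (e / k.+2%:R) *: (z - x)); last by rewrite -LE.
apply: he; rewrite /ball /= sub0r normrN gtr0_norm ?divr_gt0 ?ltr0n //.
by rewrite ltr_pdivrMr ?ltr0n // ltr_pMr // ltr1n.
Qed.

(** Where the wedge product is not 0, Cramer's rule applies; this is a dense
    subset of U, and both sides are continuous. *)
Lemma contract_wedge_open k (om : 'I_k.+1 -> 'rV[Pol]_n.+1) (U : set V)
    (v : V -> V) :
  wedge om <> 0 -> open U -> (forall x, U x -> differentiable v x) ->
  (forall x, U x -> contract (v x) (feval (wedge om) x) = 0) ->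
  forall a x, U x -> \sum_j v x 0 j * peval (om a 0 j) x = 0.
Proof.
move=> om0 oU dv vom a x Ux; apply: contrapT => /eqP gx.
pose g y := \sum_j v y 0 j * peval (om a 0 j) y.
have contg : {for x, continuous g}.
  apply: differentiable_continuous.
  rewrite (_ : g = \sum_j (fun y => v y 0 j * peval (om a 0 j) y)).
    apply: differentiable_sum => j; apply: differentiableM (differentiable_peval _ _).
    exact: (differentiable_comp (g := fun y : V => y 0 j : C) (dv x Ux)
              (differentiable_coord _ _ _)).
  by apply/funext => y; rewrite fct_sumE.
have g_neq0 : nbhs x [set y | g y != 0].
  suff /contg : nbhs (g x) [set y | y != 0] by [].
  by apply: open_nbhs_nbhs; split=> //; exact: open_neq0.
have [t omt] := form_neq0 om0.
have Ng : nbhs x ([set y | g y != 0] `&` U).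
  by apply: filterI => //; apply: open_nbhs_nbhs.
have [y [/= gy Uy] omty] := dense_nonvanishing omt Ng.
move/eqP: gy; apply; have := vom y Uy; rewrite feval_wedge => vy.
have := contract_wedge_eq0 _ vy a; rewrite /g.
under [in X in (_ -> X) -> _]eq_bigr do rewrite mxE.
apply; rewrite -feval_wedge => /ffunP/(_ t); rewrite !ffunE => e.
by move/eqP: omty; apply; rewrite ffunE.
Qed.

Lemma contract_oneform (A : comNzRingType) N (v om : 'rV[A]_N) :
  contract v (oneform om) = [ffun => \sum_j v 0 j * om 0 j].
Proof.
by apply/ffunP => t; rewrite !ffunE; apply: eq_bigr => j _; rewrite ffunE theadE.
Qed.

Lemma feval_oneform (om : 'rV[Pol]_n.+1) x :
  feval (oneform om) x = oneform (peval_row om x).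
Proof. by apply/ffunP => t; rewrite !ffunE mxE. Qed.

(** A field tangent to G is tangent to each F_i, hence so is the Lie bracket of
    two such fields. *)
Lemma integrable_intersection k (G : distribution R n k.+1)
    (om : 'I_k.+1 -> 'rV[Pol]_n.+1) (F : 'I_k.+1 -> distribution R n 1) :
  dform G = wedge om ->
  (forall i, integrable (F i) /\ dform (F i) = oneform (om i)) -> integrable G.
Proof.
move=> G_om F_om U v w oU.
have om0 : wedge om <> 0 by rewrite -G_om; apply: dform_neq0.
have tangF u a : tangent_sheaf G U u -> tangent_sheaf (F a) U u.
  move=> [hu uG]; split=> // x Ux; have [_ ->] := F_om a.
  rewrite feval_oneform contract_oneform; apply/ffunP => t; rewrite !ffunE.
  under eq_bigr do rewrite mxE.
  case: oU hu => oU _ _ [du _].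
  by apply: (contract_wedge_open om0 oU du _ _ Ux) => y Uy; rewrite -G_om uG.
move=> vG wG x Ux; rewrite G_om feval_wedge; apply: contract_wedge0 => a.
have [intF Fa] := F_om a.
have := intF U v w oU (tangF v a vG) (tangF w a wG) x Ux.
rewrite Fa feval_oneform contract_oneform => /ffunP/(_ [tuple]).
by rewrite !ffunE.
Qed.

End Flags.

Theorem theorem6p8 (R : realType) (n q k : nat)
    (D : distribution R n q) (G : distribution R n k.+1)
    (om : 'I_k.+1 -> 'rV[mpoly n.+1 (Cplx R)]_n.+1)
    (d : 'I_k.+1 -> nat) :
  reduced D -> reduced G -> flag D G ->
  (forall i, homog_oneform (d i) (om i)) ->
  dform G = wedge om ->
  split_sheaf (tangent_sheaf D) ->
  codim_ge (Sing G) (n - dist_dim D + 1)%N ->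
  [/\ (\big[minn/d ord0]_(i < k.+1) d i <= deg D + 1)%N,
      (forall F : 'I_k.+1 -> distribution R n 1,
         (forall i, integrable (F i) /\ dform (F i) = oneform (om i)) ->
         integrable G /\
         (\big[minn/deg (F ord0)]_(i < k.+1) deg (F i) <= deg D)%N) &
      ((forall i j, d i = d j) ->
         (deg G <= dist_codim G * deg D + dist_codim G - 1)%N)].
Proof.
move=> _ _ flagDG homom G_om _ codimG.
have le_deg i e : homog_oneform e (om i) -> (e <= deg D + 1)%N.
  by move=> home; apply: factor_degree_le home codimG.
have le_d i : (d i <= deg D + 1)%N by apply: le_deg (homom i).
split.
- by rewrite big_ord_recl geq_min le_d.
- move=> F F_om; split; first exact: integrable_intersection F_om.
  suff : ((deg (F ord0)).+1 <= deg D + 1)%N.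
    by rewrite addn1 ltnS big_ord_recl geq_min => ->.
  apply: (le_deg ord0) => j; have [_ Fj] := F_om ord0.
  by have := dform_homog (F ord0) [tuple j]; rewrite Fj ffunE.
- move=> _; have := degree_sum G_om homom.
  have : (\sum_i d i <= \sum_(i < k.+1) (deg D + 1))%N by apply: leq_sum.
  by rewrite sum_nat_const card_ord /dist_codim; nia.
Qed.
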